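(* Let $(\mathcal{S}_n)_{n\in\mathbb{N}}$ be the even Stern-Brocot sequence and $(\mathcal{F}_n)_{n\in\mathbb{N}}$ the Farey sequence, both defined in the context. Then, in the sense of weak convergence of finite Borel measures on $[0,1]$, \[ \lim_{n\to\infty}\ \log(n^2)\sum_{p/q\in\mathcal{S}_n} q^{-2}\,\delta_{p/q}=\lambda \qquad\text{and}\qquad \lim_{n\to\infty}\ \frac{\zeta(2)}{\log n}\sum_{p/q\in\mathcal{F}_n} q^{-2}\,\delta_{p/q}=\lambda , \] where $\lambda$ is Lebesgue measure on $[0,1]$, $\delta_x$ is the Dirac measure at $x$, and $\zeta$ is the Riemann zeta function.
   Context: All fractions $p/q$ are in lowest terms. The Farey sequence is $\mathcal{F}_n:=\{p/q: 0<p\le q\le n,\ \gcd(p,q)=1\}$. Define integers $s_{n,k},t_{n,k}$ recursively by: $s_{0,1}:=0$ and $s_{0,2}:=t_{0,1}:=t_{0,2}:=1$; $s_{n+1,2k-1}:=s_{n,k}$ and $t_{n+1,2k-1}:=t_{n,k}$ for $k=1,\dots,2^n+1$; $s_{n+1,2k}:=s_{n,k}+s_{n,k+1}$ and $t_{n+1,2k}:=t_{n,k}+t_{n,k+1}$ for $k=1,\dots,2^n$. The even Stern-Brocot sequence is $\mathcal{S}_n:=\{s_{n,2k}/t_{n,2k}: k=1,\dots,2^{n-1}\}$. Weak convergence means convergence of integrals of every continuous function $f:[0,1]\to\mathbb{R}$. *)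

(* Defs.v *)
From Stdlib Require Import Reals Lra Lia Arith List.
From Coquelicot Require Import Coquelicot.
Import ListNotations.
Open Scope R_scope.

(* Stern-Brocot: level n of the array (s_{n,k}, t_{n,k})_{k=1..2^n+1},
   encoded as the list whose (k-1)-th element is (s_{n,k}, t_{n,k}). *)
Fixpoint sb_step (l : list (nat * nat)) : list (nat * nat) :=
  match l with
  | a :: ((b :: _) as rest) =>
      a :: ((fst a + fst b)%nat, (snd a + snd b)%nat) :: sb_step rest
  | _ => l
  end.

Fixpoint sb_level (n : nat) : list (nat * nat) :=
  match n with
  | O => [(0%nat, 1%nat); (1%nat, 1%nat)]
  | S m => sb_step (sb_level m)
  end.

(* entries with even (1-based) index: positions 2,4,...,2^n, i.e. k=1..2^{n-1} *)
Fixpoint even_pos {A} (l : list A) : list A :=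
  match l with
  | _ :: b :: rest => b :: even_pos rest
  | _ => []
  end.

Definition reduce (x : nat * nat) : nat * nat :=
  let g := Nat.gcd (fst x) (snd x) in (Nat.div (fst x) g, Nat.div (snd x) g).

Definition pair_eq_dec : forall x y : nat * nat, {x = y} + {x <> y}.
Proof. decide equality; apply Nat.eq_dec. Defined.

Definition SB_set (n : nat) : list (nat * nat) :=
  nodup pair_eq_dec (map reduce (even_pos (sb_level n))).

Definition Farey_set (n : nat) : list (nat * nat) :=
  flat_map (fun q => map (fun p => (p, q))
                        (filter (fun p => Nat.eqb (Nat.gcd p q) 1) (seq 1 q)))
           (seq 1 n).

(* integral of f against the measure  sum_{p/q in A} q^{-2} delta_{p/q} *)
Definition dirac_sum (f : R -> R) (A : list (nat * nat)) : R :=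
  fold_right (fun x acc => / (INR (snd x))^2 * f (INR (fst x) / INR (snd x)) + acc) 0 A.

Definition zeta2 : R := Series (fun k => / (INR k + 1)^2).

Definition continuous_on01 (f : R -> R) : Prop :=
  forall x, 0 <= x <= 1 ->
    filterlim f (within (fun y => 0 <= y <= 1) (locally x)) (locally (f x)).

(* Main.v *)
Require Import Defs.
From Stdlib Require Import Reals List.
From Coquelicot Require Import Coquelicot.
From Stdlib Require Import Lra Lia Arith List Sorted.
From Stdlib Require FinFun.
Import ListNotations.
Open Scope R_scope.

(** Stern-Brocot part. Pulling back by the Farey map [T] gives
    [sum_{S_{n+1}} q^-2 f(p/q) = (P^n f)(1/2) / 4], [P] being the transfer operator of [T].
    If [x f(x)] is increasing and concave on [0,1], so are all the [v_j(x) = x (P^j f)(x)].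
    With [w_j = v_j(1)] one has [v_j(1/2) = w_{j+1}], hence [w] decreases and
    [w_{j+1} <= v_j <= w_j] on [1/2,1]. Sorting orbits by their last visit to [1/2,1],
    [int_0^1 f = sum_{k<=n} int_{(k+1)/(k+2)}^1 P^{n-k} f + int_0^{1/(n+2)} f],
    where the k-th summand lies between [w_{n-k+1}] and [w_{n-k}] times [ln ((k+2)/(k+1))].
    Monotonicity of [w] now gives [w_{n+1} ln (n+2) <= int f] and, for [n = 2m], a matching
    lower bound for [w_m ln (m+2)].

    Farey part. Every fraction with denominator at most [n] is a dilation of a reduced one, so
    for [f >= 0] the sum [B(n)] over all of them, which is [ln n * int f + O(1)], satisfies
    [B(n) <= zeta(2) A(n)] and [zeta_k A(n) <= B(n k)], with [A(n)] the sum over reduced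
    fractions and [zeta_k] a partial sum of [zeta(2)].

    In both parts hinge functions [max(0, x - a)] suffice, as they span the tent functions. *)

(** * Linearity and monotonicity of the weighted Dirac sums *)

Lemma dirac_sum_app f A B : dirac_sum f (A ++ B) = dirac_sum f A + dirac_sum f B.
Proof. induction A as [|x A IH]; simpl; [|rewrite IH]; ring. Qed.

Lemma dirac_sum_plus f g A :
  dirac_sum (fun x => f x + g x) A = dirac_sum f A + dirac_sum g A.
Proof. induction A as [|x A IH]; simpl; [|rewrite IH]; ring. Qed.

Lemma dirac_sum_scal c f A : dirac_sum (fun x => c * f x) A = c * dirac_sum f A.
Proof. induction A as [|x A IH]; simpl; [|rewrite IH]; ring. Qed.

Definition fraction01 (x : nat * nat) := (fst x <= snd x)%nat /\ (0 < snd x)%nat.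

Lemma fraction01_val x : fraction01 x -> 0 <= INR (fst x) / INR (snd x) <= 1.
Proof.
  intros [H1 H2]. apply le_INR in H1. apply lt_0_INR in H2.
  split.
  - apply Rdiv_le_0_compat; [apply pos_INR | easy].
  - apply Rle_div_l; lra.
Qed.

Lemma inv_sq_ge_0 n : 0 <= / (INR n) ^ 2.
Proof.
  destruct n as [|n].
  - simpl. rewrite Rmult_0_l, Rinv_0. lra.
  - left. apply Rinv_0_lt_compat, pow_lt, lt_0_INR. lia.
Qed.

Lemma dirac_sum_le f g A :
  Forall fraction01 A -> (forall x, 0 <= x <= 1 -> f x <= g x) ->
  dirac_sum f A <= dirac_sum g A.
Proof.
  intros HA H. induction HA as [|x A Hx HA IH]; simpl; [lra|].
  apply Rplus_le_compat; [|exact IH].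
  apply Rmult_le_compat_l; [exact (inv_sq_ge_0 (snd x))|].
  now apply H, fraction01_val.
Qed.

Lemma dirac_sum_ext f g A :
  Forall fraction01 A -> (forall x, 0 <= x <= 1 -> f x = g x) ->
  dirac_sum f A = dirac_sum g A.
Proof.
  intros HA H. apply Rle_antisym; apply dirac_sum_le; trivial;
    intros x Hx; rewrite (H x Hx); lra.
Qed.

Lemma dirac_sum_ge_0 f A :
  Forall fraction01 A -> (forall x, 0 <= x <= 1 -> 0 <= f x) -> 0 <= dirac_sum f A.
Proof.
  (* The zero function is written as [0 * 0] so that [dirac_sum_scal] evaluates its sum. *)
  intros HA H. replace 0 with (dirac_sum (fun _ => 0 * 0) A).
  - apply dirac_sum_le; trivial. intros x Hx. specialize (H x Hx). lra.
  - rewrite (dirac_sum_scal 0 (fun _ => 0)). ring.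
Qed.

(** * The even Stern-Brocot sequence as a tree of mediants *)

Definition mediant (a b : nat * nat) : nat * nat := (fst a + fst b, snd a + snd b)%nat.

Definition weight (f : R -> R) (x : nat * nat) : R :=
  / (INR (snd x)) ^ 2 * f (INR (fst x) / INR (snd x)).

(** Summation runs over adjacent pairs because each entry in even position of the next level is the
    mediant of such a pair. *)
Fixpoint adj_sum (F : nat * nat -> nat * nat -> R) (l : list (nat * nat)) : R :=
  match l with
  | a :: ((b :: _) as r) => F a b + adj_sum F r
  | _ => 0
  end.

(** The adjoint of [sb_step]: the subdivision acts on the summand while the list stays fixed. *)
Definition refine (F : nat * nat -> nat * nat -> R) (a b : nat * nat) : R :=
  F a (mediant a b) + F (mediant a b) b.

Lemma sb_step_cons2 a b r : sb_step (a :: b :: r) = a :: mediant a b :: sb_step (b :: r).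
Proof. reflexivity. Qed.

Lemma sb_step_head b r : exists r', sb_step (b :: r) = b :: r'.
Proof. destruct r; eexists; reflexivity. Qed.

Lemma adj_sum_sb_step F l : adj_sum F (sb_step l) = adj_sum (refine F) l.
Proof.
  induction l as [|a [|b r] IH]; [reflexivity..|].
  rewrite sb_step_cons2. destruct (sb_step_head b r) as [r' Hr].
  rewrite Hr in IH |- *.
  change (adj_sum (refine F) (a :: b :: r))
    with (refine F a b + adj_sum (refine F) (b :: r)).
  rewrite <- IH. unfold refine. simpl. ring.
Qed.

Lemma dirac_sum_even_pos f l :
  dirac_sum f (even_pos (sb_step l)) = adj_sum (fun a b => weight f (mediant a b)) l.
Proof.
  induction l as [|a [|b r] IH]; [reflexivity..|].
  rewrite sb_step_cons2.
  change (weight f (mediant a b) + dirac_sum f (even_pos (sb_step (b :: r))) =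
          weight f (mediant a b) + adj_sum (fun a b => weight f (mediant a b)) (b :: r)).
  now rewrite IH.
Qed.

Lemma adj_sum_sb_level n F :
  adj_sum F (sb_level n) = Nat.iter n refine F (0, 1)%nat (1, 1)%nat.
Proof.
  revert F. induction n as [|n IH]; intro F.
  - simpl. ring.
  - change (sb_level (S n)) with (sb_step (sb_level n)).
    now rewrite adj_sum_sb_step, IH, Nat.iter_succ_r.
Qed.

(** A map that respects mediants carries the mediant tree below [a, b] onto the tree below
    [L a, L b]. *)
Lemma iter_refine_linear (L : nat * nat -> nat * nat) n F a b :
  (forall x y, L (mediant x y) = mediant (L x) (L y)) ->
  Nat.iter n refine F (L a) (L b) =
  Nat.iter n refine (fun x y => F (L x) (L y)) a b.
Proof.
  intro HL. revert a b. induction n as [|n IH]; intros a b; simpl; [reflexivity|].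
  unfold refine at 1 3. now rewrite <- HL, !IH.
Qed.

Lemma iter_refine_plus n F G a b :
  Nat.iter n refine (fun x y => F x y + G x y) a b =
  Nat.iter n refine F a b + Nat.iter n refine G a b.
Proof.
  revert a b. induction n as [|n IH]; intros a b; simpl; [reflexivity|].
  unfold refine at 1 3 5. rewrite !IH. ring.
Qed.

Lemma iter_refine_ext n F G a b :
  (forall x y, (0 < snd x)%nat -> (0 < snd y)%nat -> F x y = G x y) ->
  (0 < snd a)%nat -> (0 < snd b)%nat ->
  Nat.iter n refine F a b = Nat.iter n refine G a b.
Proof.
  intro H. revert a b. induction n as [|n IH]; intros a b Ha Hb; simpl; [auto|].
  unfold refine at 1 3. rewrite !IH; trivial; simpl; lia.
Qed.

Lemma mediant_comm a b : mediant a b = mediant b a.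
Proof. unfold mediant. f_equal; lia. Qed.

Lemma iter_refine_sym n F a b :
  (forall x y, F x y = F y x) -> Nat.iter n refine F a b = Nat.iter n refine F b a.
Proof.
  intro H. revert a b. induction n as [|n IH]; intros a b; simpl; [auto|].
  unfold refine at 1 3. rewrite (mediant_comm b a), IH, (IH _ b). ring.
Qed.

(* The transfer operator, with respect to Lebesgue measure, of the Farey map
   [x |-> x/(1-x)] on [0,1/2], [x |-> (1-x)/x] on [1/2,1]. *)
Definition farey_op (f : R -> R) (x : R) : R :=
  / (1 + x) ^ 2 * (f (x / (1 + x)) + f (1 / (1 + x))).

Definition tree_sum n f : R :=
  Nat.iter n refine (fun a b => weight f (mediant a b)) (0, 1)%nat (1, 1)%nat.

(** Splitting at the first mediant 1/2 leaves two subtrees, the images of the whole tree under the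
    inverse branches x/(1+x) and 1/(1+x) of the Farey map. Both branches send p/q to a fraction with
    denominator p+q, whence the factor [/ (1 + x) ^ 2]. *)
Lemma tree_sum_succ n f : tree_sum (S n) f = tree_sum n (farey_op f).
Proof.
  unfold tree_sum.
  (* [L0] and [L1] are the two inverse branches on pairs. [L1] reverses order, so the ends of the
     right subtree are exchanged by symmetry before it is applied. *)
  pose (L0 := fun x : nat * nat => (fst x, fst x + snd x)%nat).
  pose (L1 := fun x : nat * nat => (snd x, fst x + snd x)%nat).
  assert (HL0 : forall x y, L0 (mediant x y) = mediant (L0 x) (L0 y))
    by (intros [] []; unfold L0, mediant; simpl; f_equal; lia).
  assert (HL1 : forall x y, L1 (mediant x y) = mediant (L1 x) (L1 y))
    by (intros [] []; unfold L1, mediant; simpl; f_equal; lia).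
  simpl Nat.iter at 1. unfold refine at 1.
  rewrite (iter_refine_sym n _ (mediant _ _)) by (intros; now rewrite mediant_comm).
  change (mediant (0, 1)%nat (1, 1)%nat) with (L0 (1, 1)%nat) at 1.
  change (mediant (0, 1)%nat (1, 1)%nat) with (L1 (1, 1)%nat).
  replace (Nat.iter n refine (fun a b => weight f (mediant a b)) (0, 1)%nat (L0 (1, 1)%nat))
    with (Nat.iter n refine (fun a b => weight f (mediant a b)) (L0 (0, 1)%nat) (L0 (1, 1)%nat))
    by reflexivity.
  replace (Nat.iter n refine (fun a b => weight f (mediant a b)) (1, 1)%nat (L1 (1, 1)%nat))
    with (Nat.iter n refine (fun a b => weight f (mediant a b)) (L1 (0, 1)%nat) (L1 (1, 1)%nat))
    by reflexivity.
  rewrite (iter_refine_linear L0), (iter_refine_linear L1), <- iter_refine_plus by trivial.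
  apply iter_refine_ext; [|simpl; lia..].
  intros x y Hx Hy.
  unfold weight, L0, L1, mediant, farey_op. simpl fst. simpl snd.
  assert (H : 0 < INR (snd x + snd y)) by (apply lt_0_INR; lia).
  assert (H' := pos_INR (fst x + fst y)).
  replace (fst x + snd x + (fst y + snd y))%nat
    with ((fst x + fst y) + (snd x + snd y))%nat by lia.
  rewrite (plus_INR (fst x + fst y) (snd x + snd y)).
  set (q := INR (snd x + snd y)) in *. set (p := INR (fst x + fst y)) in *.
  replace (p / q / (1 + p / q)) with (p / (p + q)) by (field; lra).
  replace (1 / (1 + p / q)) with (q / (p + q)) by (field; lra).
  field. lra.
Qed.

Lemma tree_sum_iter n f : tree_sum n f = / 4 * Nat.iter n farey_op f (1 / 2).
Proof.
  revert f. induction n as [|n IH]; intro f.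
  - unfold tree_sum, weight. simpl.
    replace (1 / (1 + 1)) with (1 / 2) by lra. f_equal. field.
  - now rewrite tree_sum_succ, IH, Nat.iter_succ_r.
Qed.

(* Consecutive fractions [x < y] of a level are Farey neighbours. *)
Definition neighbours (x y : nat * nat) :=
  (0 < snd x)%nat /\ (0 < snd y)%nat /\ (fst y * snd x = fst x * snd y + 1)%nat.

Lemma Sorted_neighbours_sb_step l : Sorted neighbours l -> Sorted neighbours (sb_step l).
Proof.
  induction l as [|a [|b r] IH]; intro H; [exact H..|].
  rewrite sb_step_cons2. apply Sorted_inv in H. destruct H as [H Hab].
  apply HdRel_inv in Hab. specialize (IH H).
  destruct (sb_step_head b r) as [r' Hr]. rewrite Hr in *.
  unfold neighbours in Hab.
  constructor; [constructor; [exact IH|]|]; constructor;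
    unfold neighbours, mediant; simpl; lia.
Qed.

Lemma Sorted_neighbours_sb_level n : Sorted neighbours (sb_level n).
Proof.
  induction n as [|n IH]; [|now apply Sorted_neighbours_sb_step].
  repeat constructor.
Qed.

(** Induction in steps of two, matching the recursion of [even_pos]. *)
Lemma list_ind2 {A} (P : list A -> Prop) :
  P [] -> (forall a, P [a]) -> (forall a b r, P r -> P (a :: b :: r)) -> forall l, P l.
Proof.
  intros H0 H1 H2. fix IH 1. intros [|a [|b r]]; [exact H0 | apply H1 | apply H2, IH].
Qed.

Lemma incl_even_pos {A} (l : list A) : incl (even_pos l) l.
Proof.
  induction l as [|a|a b r IH] using list_ind2; intros x Hx; simpl in *; try easy.
  destruct Hx as [<-|Hx]; auto.
Qed.

(** The neighbour relation between an even entry and its predecessor is a Bezout identity. *)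
Lemma Sorted_even_pos_coprime l :
  Sorted neighbours l -> Forall (fun x => Nat.gcd (fst x) (snd x) = 1%nat) (even_pos l).
Proof.
  induction l as [|a|a b r IH] using list_ind2; intro H; simpl; constructor.
  - apply Sorted_inv in H. destruct H as [_ H]. apply HdRel_inv in H.
    destruct H as [_ [_ H]]. apply Nat.bezout_1_gcd.
    exists (snd a), (fst a). lia.
  - apply IH. apply Sorted_inv in H. destruct H as [H _].
    now apply Sorted_inv in H.
Qed.

Definition frac (x : nat * nat) : R := INR (fst x) / INR (snd x).

Lemma neighbours_frac x y : neighbours x y -> frac x < frac y.
Proof.
  intros [Hx [Hy H]]. unfold frac.
  apply (f_equal INR) in H. rewrite plus_INR, !mult_INR in H. simpl in H.
  apply lt_0_INR in Hx, Hy.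
  apply (Rmult_lt_reg_r (INR (snd x) * INR (snd y))); [now apply Rmult_lt_0_compat|].
  replace (_ / _ * _) with (INR (fst x) * INR (snd y)) by (field; lra).
  replace (_ / _ * _) with (INR (fst y) * INR (snd x)) by (field; lra).
  lra.
Qed.

(** Fractions increase strictly along a level, so no pair can recur. *)
Lemma NoDup_even_pos l : Sorted neighbours l -> NoDup (even_pos l).
Proof.
  intro H.
  assert (HS : StronglySorted (fun x y => frac x < frac y) l).
  { apply Sorted_StronglySorted; [intros x y z; apply Rlt_trans|].
    clear - H. induction H as [|a l H IH Ha]; constructor; trivial.
    destruct Ha; constructor. now apply neighbours_frac. }
  clear H. induction l as [|a|a b r IH] using list_ind2; simpl; constructor.
  - intro Hb. apply incl_even_pos in Hb.
    apply StronglySorted_inv in HS. destruct HS as [HS _].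
    apply StronglySorted_inv in HS. destruct HS as [_ HS].
    rewrite Forall_forall in HS. specialize (HS b Hb). lra.
  - apply IH. apply StronglySorted_inv in HS. destruct HS as [HS _].
    now apply StronglySorted_inv in HS.
Qed.

Lemma Forall_fraction01_sb_level n : Forall fraction01 (sb_level n).
Proof.
  induction n as [|n IH]; [unfold fraction01; repeat constructor|].
  change (Forall fraction01 (sb_step (sb_level n))).
  revert IH. generalize (sb_level n). intro l.
  induction l as [|a [|b r] IH]; intro H; [exact H..|].
  rewrite sb_step_cons2. inversion_clear H as [|? ? Ha Hr].
  constructor; [easy|]. constructor; [|auto].
  inversion_clear Hr as [|? ? Hb _].
  unfold fraction01, mediant in *. simpl. lia.
Qed.

(** The even entries are already coprime and distinct, so [reduce] and [nodup] act as the
    identity. *)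
Lemma SB_set_even_pos n : SB_set n = even_pos (sb_level n).
Proof.
  assert (H := Sorted_neighbours_sb_level n).
  unfold SB_set. rewrite (map_ext_in reduce (fun x => x)), map_id.
  - now apply nodup_fixed_point, NoDup_even_pos.
  - intros [p q] Hx. apply Sorted_even_pos_coprime in H.
    rewrite Forall_forall in H. specialize (H _ Hx).
    unfold reduce. now rewrite H, !Nat.div_1_r.
Qed.

Lemma Forall_fraction01_SB_set n : Forall fraction01 (SB_set n).
Proof.
  rewrite SB_set_even_pos. apply Forall_forall. intros x Hx.
  apply incl_even_pos in Hx. revert x Hx. apply Forall_forall, Forall_fraction01_sb_level.
Qed.

Lemma dirac_sum_SB_set n f :
  dirac_sum f (SB_set (S n)) = / 4 * Nat.iter n farey_op f (1 / 2).
Proof.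
  rewrite SB_set_even_pos. simpl sb_level.
  now rewrite dirac_sum_even_pos, adj_sum_sb_level, <- tree_sum_iter.
Qed.

(** * Decay of the iterates of the transfer operator *)

(** To be applied to [x * f x], the density of [f] relative to the invariant density 1/x of the
    Farey map. The class is stable under [farey_op]. *)
Definition incr_concave (u : R -> R) :=
  (forall x y, 0 <= x -> x <= y -> y <= 1 -> u x <= u y) /\
  (forall x y t, 0 <= x <= 1 -> 0 <= y <= 1 -> 0 <= t <= 1 ->
     t * u x + (1 - t) * u y <= u (t * x + (1 - t) * y)).

(* [x * farey_op f x = fold_half u (x / (1 + x))] where [u x = x * f x]. *)
Definition fold_half (u : R -> R) (y : R) : R := (1 - y) * u y + y * u (1 - y).

(** The difference of the two sides is y (u(z) + u(1-z) - u(y) - u(1-y)) + (1-y-z) (u(z) - u(y)) +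
    (z-y) (u(1-z) - u(y)). The first term is nonnegative by concavity, as z and 1-z lie between y
    and 1-y; the other two by monotonicity. *)
Lemma fold_half_incr u y z :
  incr_concave u -> 0 <= y -> y <= z -> z <= 1 / 2 -> fold_half u y <= fold_half u z.
Proof.
  intros [Hi Hc] Hy Hyz Hz. unfold fold_half.
  (* Without this case [1 - 2 * y] could vanish in the weight [t], for which z = t y + (1-t)
     (1-y). *)
  destruct (Req_dec y z) as [<-|Hne]; [lra|].
  assert (Hlt : y < 1 - y) by lra.
  pose (t := (1 - y - z) / (1 - 2 * y)).
  assert (Ht : 0 <= t <= 1).
  { unfold t. split; [apply Rdiv_le_0_compat; lra|].
    apply Rle_div_l; lra. }
  assert (H1 := Hc y (1 - y) t ltac:(lra) ltac:(lra) Ht).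
  assert (H2 := Hc y (1 - y) (1 - t) ltac:(lra) ltac:(lra) ltac:(lra)).
  replace (t * y + (1 - t) * (1 - y)) with z in H1 by (unfold t; field; lra).
  replace ((1 - t) * y + (1 - (1 - t)) * (1 - y)) with (1 - z) in H2 by (unfold t; field; lra).
  assert (H3 : u y + u (1 - y) <= u z + u (1 - z)) by lra.
  assert (H4 := Hi y (1 - z) Hy ltac:(lra) ltac:(lra)).
  assert (H5 := Hi y z Hy ltac:(lra) ltac:(lra)).
  clear H1 H2. nra.
Qed.

(** With the coefficients frozen at [1 - y] and [y], this is concavity of [u]. Their variation adds
    a covariance term of favourable sign, since both [u] and y |-> - u(1-y) are nondecreasing. *)
Lemma fold_half_concave u y1 y2 t :
  incr_concave u -> 0 <= y1 <= 1 / 2 -> 0 <= y2 <= 1 / 2 -> 0 <= t <= 1 ->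
  t * fold_half u y1 + (1 - t) * fold_half u y2 <= fold_half u (t * y1 + (1 - t) * y2).
Proof.
  intros [Hi Hc] H1 H2 Ht. unfold fold_half.
  set (y := t * y1 + (1 - t) * y2).
  assert (Hy : 0 <= y <= 1 / 2) by (unfold y; nra).
  assert (A1 := Hc y1 y2 t ltac:(lra) ltac:(lra) Ht).
  assert (A2 := Hc (1 - y1) (1 - y2) t ltac:(lra) ltac:(lra) Ht).
  fold y in A1.
  replace (t * (1 - y1) + (1 - t) * (1 - y2)) with (1 - y) in A2 by (unfold y; ring).
  assert (B1 := Rmult_le_compat_l (1 - y) _ _ ltac:(lra) A1).
  assert (B2 := Rmult_le_compat_l y _ _ ltac:(lra) A2).
  assert (HM : 0 <= (y2 - y1) * (u y2 - u y1 + (u (1 - y1) - u (1 - y2)))).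
  { destruct (Rle_dec y1 y2) as [H|H].
    - assert (C1 := Hi y1 y2 ltac:(lra) ltac:(lra) ltac:(lra)).
      assert (C2 := Hi (1 - y2) (1 - y1) ltac:(lra) ltac:(lra) ltac:(lra)).
      apply Rmult_le_pos; lra.
    - assert (C1 := Hi y2 y1 ltac:(lra) ltac:(lra) ltac:(lra)).
      assert (C2 := Hi (1 - y1) (1 - y2) ltac:(lra) ltac:(lra) ltac:(lra)).
      nra. }
  assert (HT : 0 <= t * (1 - t)) by nra.
  assert (HP := Rmult_le_pos _ _ HT HM).
  replace (t * ((1 - y1) * u y1 + y1 * u (1 - y1)) +
           (1 - t) * ((1 - y2) * u y2 + y2 * u (1 - y2)))
    with ((1 - y) * (t * u y1 + (1 - t) * u y2) +
          y * (t * u (1 - y1) + (1 - t) * u (1 - y2)) -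
          t * (1 - t) * ((y2 - y1) * (u y2 - u y1 + (u (1 - y1) - u (1 - y2)))))
    by (unfold y; ring).
  lra.
Qed.

Lemma half_map_bounds x : 0 <= x <= 1 -> 0 <= x / (1 + x) <= 1 / 2.
Proof.
  intro H. split; [apply Rdiv_le_0_compat; lra|]. apply Rle_div_l; lra.
Qed.

Lemma half_map_incr x y : 0 <= x -> x <= y -> x / (1 + x) <= y / (1 + y).
Proof.
  intros H1 H2.
  replace (x / (1 + x)) with (1 - / (1 + x)) by (field; lra).
  replace (y / (1 + y)) with (1 - / (1 + y)) by (field; lra).
  assert (/ (1 + y) <= / (1 + x)) by (apply Rinv_le_contravar; lra). lra.
Qed.

Lemma half_map_concave x y t :
  0 <= x -> 0 <= y -> 0 <= t <= 1 ->
  t * (x / (1 + x)) + (1 - t) * (y / (1 + y)) <=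
  (t * x + (1 - t) * y) / (1 + (t * x + (1 - t) * y)).
Proof.
  intros Hx Hy Ht. set (z := t * x + (1 - t) * y).
  assert (Hz : 0 <= z) by (unfold z; nra).
  assert (E : z / (1 + z) - (t * (x / (1 + x)) + (1 - t) * (y / (1 + y))) =
              t * (1 - t) * (x - y) ^ 2 / ((1 + x) * (1 + y) * (1 + z))).
  { unfold z in *. field. repeat split; lra. }
  assert (0 <= t * (1 - t) * (x - y) ^ 2 / ((1 + x) * (1 + y) * (1 + z))).
  { apply Rdiv_le_0_compat.
    - apply Rmult_le_pos; [nra | apply pow2_ge_0].
    - repeat apply Rmult_lt_0_compat; lra. }
  lra.
Qed.

Lemma farey_op_fold_half f x :
  0 <= x -> x * farey_op f x = fold_half (fun y => y * f y) (x / (1 + x)).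
Proof.
  intro Hx. unfold farey_op, fold_half.
  replace (1 - x / (1 + x)) with (1 / (1 + x)) by (field; lra).
  field. lra.
Qed.

(** A nondecreasing concave function on [0,1/2] composed with the increasing concave map x/(1+x) is
    again nondecreasing and concave. *)
Lemma incr_concave_farey_op f :
  incr_concave (fun x => x * f x) -> incr_concave (fun x => x * farey_op f x).
Proof.
  intro H. split.
  - intros x y Hx Hxy Hy. rewrite !farey_op_fold_half by lra.
    apply fold_half_incr; trivial.
    + now apply half_map_bounds; lra.
    + now apply half_map_incr.
    + apply half_map_bounds; lra.
  - intros x y t Hx Hy Ht.
    assert (Hz : 0 <= t * x + (1 - t) * y <= 1) by nra.
    rewrite !farey_op_fold_half by lra.
    assert (Bx := half_map_bounds x Hx). assert (By := half_map_bounds y Hy).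
    eapply Rle_trans; [now apply fold_half_concave|].
    apply fold_half_incr; trivial.
    + nra.
    + apply half_map_concave; lra.
    + now apply half_map_bounds.
Qed.

Lemma farey_op_1 f : farey_op f 1 = 1 / 2 * f (1 / 2).
Proof. unfold farey_op. replace (1 + 1) with 2 by ring. field. Qed.

(** * Continuity, integrals and mass balance of the iterates *)

Lemma continuous_farey_op (f : R -> R) :
  (forall x, 0 <= x <= 1 -> continuous f x) ->
  forall x, 0 <= x <= 1 -> continuous (farey_op f) x.
Proof.
  intros Hf x Hx. assert (B := half_map_bounds x Hx).
  assert (E : 1 / (1 + x) = 1 - x / (1 + x)) by (field; lra).
  unfold farey_op.
  apply (continuous_mult (fun x => / (1 + x) ^ 2)).
  - apply (ex_derive_continuous (V := R_NormedModule)). auto_derive.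
    apply Rmult_integral_contrapositive_currified; lra.
  - apply (continuous_plus (fun x => f (x / (1 + x))) (fun x => f (1 / (1 + x)))).
    + apply (continuous_comp (fun x => x / (1 + x)) f).
      * apply (ex_derive_continuous (V := R_NormedModule)). auto_derive. lra.
      * apply Hf. lra.
    + apply (continuous_comp (fun x => 1 / (1 + x)) f).
      * apply (ex_derive_continuous (V := R_NormedModule)). auto_derive. lra.
      * apply Hf. lra.
Qed.

Lemma ex_RInt_sub01 (f : R -> R) a b :
  (forall x, 0 <= x <= 1 -> continuous f x) -> 0 <= a <= 1 -> 0 <= b <= 1 -> ex_RInt f a b.
Proof.
  intros Hf Ha Hb. apply (ex_RInt_continuous (V := R_CompleteNormedModule)).
  intros z Hz. apply Hf. unfold Rmin, Rmax in Hz. destruct (Rle_dec a b); lra.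
Qed.

(** Change of variables along the two inverse branches: the right side integrates [f] over the
    preimage of [0,c] under the Farey map. *)
Lemma RInt_farey_op (f : R -> R) c :
  (forall x, 0 <= x <= 1 -> continuous f x) -> 0 <= c <= 1 ->
  RInt (farey_op f) 0 c = RInt f 0 (c / (1 + c)) + RInt f (1 / (1 + c)) 1.
Proof.
  intros Hf Hc.
  assert (S0 : RInt (fun y => / (1 + y) ^ 2 * f (y / (1 + y))) 0 c = RInt f 0 (c / (1 + c)) /\
               ex_RInt (fun y => / (1 + y) ^ 2 * f (y / (1 + y))) 0 c).
  { assert (HI : is_RInt (fun y => scal (/ (1 + y) ^ 2) (f (y / (1 + y)))) 0 c
      (RInt f (0 / (1 + 0)) (c / (1 + c)))).
    { apply (is_RInt_comp f (fun x => x / (1 + x)) (fun x => / (1 + x) ^ 2));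
        rewrite Rmin_left, Rmax_right by lra; intros x Hx.
      - apply Hf. assert (B := half_map_bounds x ltac:(lra)). lra.
      - split.
        + auto_derive; [lra|]. field. lra.
        + apply (ex_derive_continuous (V := R_NormedModule)). auto_derive.
          apply Rmult_integral_contrapositive_currified; lra. }
    replace (0 / (1 + 0)) with 0 in HI by field.
    split; [now apply is_RInt_unique | now eexists; exact HI]. }
  assert (S1 : RInt (fun y => / (1 + y) ^ 2 * f (1 / (1 + y))) 0 c = RInt f (1 / (1 + c)) 1 /\
               ex_RInt (fun y => / (1 + y) ^ 2 * f (1 / (1 + y))) 0 c).
  { assert (HI : is_RInt (fun y => scal (- / (1 + y) ^ 2) (f (1 / (1 + y)))) 0 c
      (RInt f (1 / (1 + 0)) (1 / (1 + c)))).
    { apply (is_RInt_comp f (fun x => 1 / (1 + x)) (fun x => - / (1 + x) ^ 2));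
        rewrite Rmin_left, Rmax_right by lra; intros x Hx.
      - apply Hf. assert (B := half_map_bounds x ltac:(lra)).
        assert (E : 1 / (1 + x) = 1 - x / (1 + x)) by (field; lra). lra.
      - split.
        + auto_derive; [lra|]. field. lra.
        + apply (ex_derive_continuous (V := R_NormedModule)). auto_derive.
          apply Rmult_integral_contrapositive_currified; lra. }
    replace (1 / (1 + 0)) with 1 in HI by field.
    (* The branch 1/(1+x) decreases, so the substitution comes out with a negative sign and
       exchanged bounds. *)
    apply (is_RInt_opp (V := R_NormedModule)) in HI.
    assert (HJ : is_RInt (fun y => / (1 + y) ^ 2 * f (1 / (1 + y))) 0 c
                   (RInt f (1 / (1 + c)) 1)).
    { rewrite <- (opp_RInt_swap (V := R_CompleteNormedModule)).
      - eapply is_RInt_ext; [|exact HI]. intros y _.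
        unfold opp, scal; simpl; unfold mult; simpl. ring.
      - assert (B := half_map_bounds c Hc).
        assert (E : 1 / (1 + c) = 1 - c / (1 + c)) by (field; lra).
        apply ex_RInt_sub01; trivial; lra. }
    split; [now apply is_RInt_unique | now eexists; exact HJ]. }
  destruct S0 as [<- E0], S1 as [<- E1].
  rewrite <- (RInt_plus (V := R_CompleteNormedModule)) by trivial.
  apply RInt_ext. intros x _. unfold farey_op, plus; simpl. ring.
Qed.

Lemma continuous_iter_farey_op (f : R -> R) n :
  (forall x, 0 <= x <= 1 -> continuous f x) ->
  forall x, 0 <= x <= 1 -> continuous (Nat.iter n farey_op f) x.
Proof.
  intro Hf. induction n as [|n IH]; [exact Hf|]. now apply continuous_farey_op.
Qed.

Lemma incr_concave_iter_farey_op f n :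
  incr_concave (fun x => x * f x) -> incr_concave (fun x => x * Nat.iter n farey_op f x).
Proof.
  intro Hf. induction n as [|n IH]; [exact Hf|]. now apply incr_concave_farey_op.
Qed.

(* The point 1 maps to 1/2 under one inverse branch, so that the values at the two
   endpoints of [1/2,1] belong to the same sequence. *)
Lemma iter_farey_op_bounds f n x :
  incr_concave (fun x => x * f x) -> 1 / 2 <= x <= 1 ->
  Nat.iter (S n) farey_op f 1 / x <= Nat.iter n farey_op f x <= Nat.iter n farey_op f 1 / x.
Proof.
  intros Hf Hx. simpl Nat.iter at 1. rewrite farey_op_1.
  destruct (incr_concave_iter_farey_op f n Hf) as [H _].
  assert (H1 := H (1 / 2) x ltac:(lra) ltac:(lra) ltac:(lra)).
  assert (H2 := H x 1 ltac:(lra) ltac:(lra) ltac:(lra)).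
  split.
  - apply Rle_div_l; lra.
  - apply Rle_div_r; lra.
Qed.

(** The product with [x] is nondecreasing and vanishes at 0. *)
Lemma iter_farey_op_ge_0 f n x :
  incr_concave (fun x => x * f x) -> 0 < x <= 1 -> 0 <= Nat.iter n farey_op f x.
Proof.
  intros Hf Hx. destruct (incr_concave_iter_farey_op f n Hf) as [H _].
  assert (H1 := H 0 x ltac:(lra) ltac:(lra) ltac:(lra)). nra.
Qed.

Lemma iter_farey_op_1_decr f m n :
  incr_concave (fun x => x * f x) -> (m <= n)%nat ->
  Nat.iter n farey_op f 1 <= Nat.iter m farey_op f 1.
Proof.
  intros Hf Hmn. induction Hmn as [|n Hmn IH]; [lra|].
  assert (H := iter_farey_op_bounds f n 1 Hf ltac:(lra)). lra.
Qed.

Lemma is_RInt_const_div a c :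
  0 <= c -> is_RInt (fun x => a / x) (1 / (1 + c)) 1 (a * ln (1 + c)).
Proof.
  intro Hc.
  assert (H0 : 0 < 1 / (1 + c)) by (apply Rdiv_lt_0_compat; lra).
  assert (H1 : 1 / (1 + c) <= 1) by (apply Rle_div_l; lra).
  replace (a * ln (1 + c)) with (minus (a * ln 1) (a * ln (1 / (1 + c)))).
  - apply (is_RInt_derive (fun x => a * ln x)); rewrite Rmin_left, Rmax_right by lra;
      intros x Hx.
    + auto_derive; [lra|]. field. lra.
    + apply (ex_derive_continuous (V := R_NormedModule)). auto_derive. lra.
  - unfold minus, plus, opp; simpl. unfold Rdiv at 1.
    rewrite Rmult_1_l, ln_Rinv, ln_1 by lra. ring.
Qed.

Lemma RInt_iter_farey_op_bounds (f : R -> R) n c :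
  (forall x, 0 <= x <= 1 -> continuous f x) -> incr_concave (fun x => x * f x) ->
  0 <= c <= 1 ->
  Nat.iter (S n) farey_op f 1 * ln (1 + c) <=
    RInt (Nat.iter n farey_op f) (1 / (1 + c)) 1 <= Nat.iter n farey_op f 1 * ln (1 + c).
Proof.
  intros Hf Hu Hc.
  assert (H0 : 1 / 2 <= 1 / (1 + c)) by (apply -> Rle_div_r; lra).
  assert (H1 : 1 / (1 + c) <= 1) by (apply Rle_div_l; lra).
  assert (HI : ex_RInt (Nat.iter n farey_op f) (1 / (1 + c)) 1)
    by (apply ex_RInt_sub01; [now apply continuous_iter_farey_op|lra..]).
  split.
  - rewrite <- (is_RInt_unique _ _ _ _ (is_RInt_const_div _ c (proj1 Hc))).
    apply RInt_le; trivial; [eexists; now apply is_RInt_const_div|].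
    intros x Hx. apply iter_farey_op_bounds; trivial; lra.
  - rewrite <- (is_RInt_unique _ _ _ _ (is_RInt_const_div _ c (proj1 Hc))).
    apply RInt_le; trivial; [eexists; now apply is_RInt_const_div|].
    intros x Hx. apply iter_farey_op_bounds; trivial; lra.
Qed.

Lemma inv_succ_bounds k : 0 < / (INR k + 1) <= 1.
Proof.
  assert (H := pos_INR k). split; [apply Rinv_0_lt_compat; lra|].
  rewrite <- Rinv_1. apply Rinv_le_contravar; lra.
Qed.

Lemma RInt_iter_farey_op_01 (f : R -> R) n :
  (forall x, 0 <= x <= 1 -> continuous f x) ->
  RInt (Nat.iter n farey_op f) 0 1 = RInt f 0 1.
Proof.
  intro Hf. induction n as [|n IH]; [reflexivity|].
  assert (HQ := continuous_iter_farey_op f n Hf).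
  rewrite <- IH. simpl. rewrite RInt_farey_op by (trivial; lra).
  replace (1 / (1 + 1)) with (1 / 2) by lra.
  apply (RInt_Chasles (V := R_CompleteNormedModule)); apply ex_RInt_sub01; trivial; lra.
Qed.

(* Mass balance: orbits are sorted by the time of their last visit to [1/2,1]. *)
Lemma RInt_last_visit (f : R -> R) n k :
  (forall x, 0 <= x <= 1 -> continuous f x) ->
  RInt (Nat.iter (S n) farey_op f) 0 (/ (INR k + 1)) =
  RInt f 0 (/ (INR (k + S n) + 1)) +
  sum_f_R0 (fun i => RInt (Nat.iter (n - i) farey_op f) (1 / (1 + / (INR (k + i) + 1))) 1) n.
Proof.
  intro Hf.
  (* The preimage of [0,1/(k+1)] consists of [0,1/(k+2)], which is treated again, and
     [(k+1)/(k+2),1], which is split off. *)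
  assert (step : forall j k, RInt (Nat.iter (S j) farey_op f) 0 (/ (INR k + 1)) =
    RInt (Nat.iter j farey_op f) 0 (/ (INR (S k) + 1)) +
    RInt (Nat.iter j farey_op f) (1 / (1 + / (INR k + 1))) 1).
  { clear n k. intros j k. assert (B := inv_succ_bounds k). assert (B' := pos_INR k).
    simpl Nat.iter at 1.
    rewrite RInt_farey_op by (try (now apply continuous_iter_farey_op); lra).
    do 2 f_equal. rewrite S_INR. field. lra. }
  revert k. induction n as [|n IH]; intro k.
  - rewrite step. simpl sum_f_R0. rewrite Nat.add_0_r, Nat.add_1_r. reflexivity.
  - rewrite step, IH, (decomp_sum _ (S n)) by lia. simpl pred.
    rewrite Nat.add_0_r, Nat.sub_0_r. replace (S k + S n)%nat with (k + S (S n))%nat by lia.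
    rewrite Rplus_assoc. f_equal. rewrite Rplus_comm. f_equal.
    apply sum_eq. intros i Hi. now replace (S k + i)%nat with (k + S i)%nat by lia.
Qed.

(** Telescoping, since 1 + 1/(k+1) = (k+2)/(k+1). *)
Lemma sum_ln_succ n :
  sum_f_R0 (fun k => ln (1 + / (INR k + 1))) n = ln (INR n + 2).
Proof.
  induction n as [|n IH].
  - simpl. f_equal. field.
  - rewrite tech5, IH. assert (H := pos_INR n). rewrite S_INR.
    rewrite <- ln_mult; [f_equal; field; lra | lra |].
    assert (0 < / (INR n + 1 + 1)) by (apply Rinv_0_lt_compat; lra). lra.
Qed.

Lemma sum_f_R0_rev g n : sum_f_R0 (fun i => g (n - i)%nat) n = sum_f_R0 g n.
Proof.
  induction n as [|n IH]; [reflexivity|].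
  rewrite (decomp_sum _ (S n)) by lia. simpl pred. rewrite tech5, Nat.sub_0_r, Rplus_comm.
  f_equal. exact IH.
Qed.

Lemma ln_succ_bounds k : 0 <= ln (1 + / (INR k + 1)) <= / (INR k + 1).
Proof.
  assert (B := inv_succ_bounds k). split.
  - rewrite <- ln_1. apply ln_le; lra.
  - rewrite <- (ln_exp (/ (INR k + 1))) at 2.
    apply ln_le; [lra|]. apply exp_ineq1_le.
Qed.

(** In the mass balance over [0,1] the k-th term is at least w_{n-k+1} ln((k+2)/(k+1)), and
    w_{n-k+1} >= w_{n+1}. The remaining mass near 0 is nonnegative. *)
Lemma iter_farey_op_upper (f : R -> R) n :
  (forall x, 0 <= x <= 1 -> continuous f x) -> incr_concave (fun x => x * f x) ->
  Nat.iter (S n) farey_op f 1 * ln (INR n + 2) <= RInt f 0 1.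
Proof.
  intros Hf Hu. rewrite <- (RInt_iter_farey_op_01 f (S n) Hf).
  assert (H := RInt_last_visit f n 0 Hf). change (INR 0) with 0 in H.
  replace (/ (0 + 1)) with 1 in H by field. rewrite H.
  assert (H0 : 0 <= RInt f 0 (/ (INR (0 + S n) + 1))).
  { assert (B := inv_succ_bounds (0 + S n)).
    apply RInt_ge_0; [lra | apply ex_RInt_sub01; trivial; lra |].
    intros x Hx. apply (iter_farey_op_ge_0 f 0); trivial; lra. }
  enough (Nat.iter (S n) farey_op f 1 * ln (INR n + 2) <= sum_f_R0 (fun i =>
    RInt (Nat.iter (n - i) farey_op f) (1 / (1 + / (INR (0 + i) + 1))) 1) n) by lra.
  rewrite <- sum_ln_succ, scal_sum. apply sum_Rle. intros k Hk. simpl plus.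
  assert (B := inv_succ_bounds k). assert (L := ln_succ_bounds k).
  eapply Rle_trans; [|apply (RInt_iter_farey_op_bounds f (n - k) (/ (INR k + 1))); trivial; lra].
  rewrite Rmult_comm. apply Rmult_le_compat_r; [lra|].
  apply iter_farey_op_1_decr; trivial; lia.
Qed.

(** With M = [S m], the mass balance with n = 2M is cut after k = M. Up to there w_{n-k} <= w_M and
    the logarithms add up to ln(M+2). Beyond it each logarithm is at most 1/M while n-k runs through
    m, ..., 0, which leaves a Cesaro mean of w. The mass near 0 is at most C/(M+1). *)
Lemma iter_farey_op_lower (f : R -> R) C m :
  (forall x, 0 <= x <= 1 -> continuous f x) -> incr_concave (fun x => x * f x) ->
  (forall x, 0 <= x <= 1 -> f x <= C) ->
  RInt f 0 1 - C / (INR (S m) + 1) <=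
  Nat.iter (S m) farey_op f 1 * ln (INR (S m) + 2) +
  sum_f_R0 (fun j => Nat.iter j farey_op f 1) m / INR (S m).
Proof.
  intros Hf Hu HC. set (w := fun j => Nat.iter j farey_op f 1).
  pose (n := (2 * S m)%nat).
  rewrite <- (RInt_iter_farey_op_01 f (S n) Hf).
  assert (H := RInt_last_visit f n 0 Hf). change (INR 0) with 0 in H.
  replace (/ (0 + 1)) with 1 in H by field. rewrite H. clear H.
  assert (HC0 : 0 <= C).
  { apply Rle_trans with (f 1); [apply (iter_farey_op_ge_0 f 0); trivial; lra|].
    apply HC; lra. }
  assert (H0 : RInt f 0 (/ (INR (0 + S n) + 1)) <= C / (INR (S m) + 1)).
  { assert (B := inv_succ_bounds (0 + S n)). assert (B' := pos_INR (S m)).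
    apply Rle_trans with (RInt (fun _ => C) 0 (/ (INR (0 + S n) + 1))).
    - apply RInt_le; [lra | apply ex_RInt_sub01; trivial; lra | apply ex_RInt_const |].
      intros x Hx. apply HC. lra.
    - rewrite RInt_const. change (@scal _ R_NormedModule) with Rmult. rewrite Rminus_0_r, Rmult_comm.
      apply Rmult_le_compat_l; trivial. apply Rinv_le_contravar; [lra|].
      apply Rplus_le_compat_r, (le_INR (S m) (S n)). unfold n. lia. }
  assert (HS : sum_f_R0 (fun i =>
      RInt (Nat.iter (n - i) farey_op f) (1 / (1 + / (INR (0 + i) + 1))) 1) n <=
      sum_f_R0 (fun k => w (n - k)%nat * ln (1 + / (INR k + 1))) n).
  { apply sum_Rle. intros k Hk. assert (B := inv_succ_bounds k).
    apply (RInt_iter_farey_op_bounds f (n - k) (/ (INR k + 1))); trivial; lra. }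
  rewrite (tech2 _ (S m) n) in HS |- * by (unfold n; lia).
  rewrite (tech2 (fun k => w (n - k)%nat * ln (1 + / (INR k + 1))) (S m) n)
    in HS by (unfold n; lia).
  assert (H1 : sum_f_R0 (fun k => w (n - k)%nat * ln (1 + / (INR k + 1))) (S m) <=
               w (S m) * ln (INR (S m) + 2)).
  { rewrite <- sum_ln_succ, scal_sum. apply sum_Rle. intros k Hk. rewrite Rmult_comm.
    apply Rmult_le_compat_l; [apply ln_succ_bounds|].
    apply iter_farey_op_1_decr; trivial. unfold n. lia. }
  assert (H2 : sum_f_R0 (fun i => w (n - (S (S m) + i))%nat * ln (1 + / (INR (S (S m) + i) + 1)))
                 (n - S (S m)) <= sum_f_R0 w m / INR (S m)).
  { replace (n - S (S m))%nat with m by (unfold n; lia).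
    unfold Rdiv. rewrite <- (sum_f_R0_rev w), Rmult_comm, scal_sum.
    apply sum_Rle. intros i Hi. replace (n - (S (S m) + i))%nat with (m - i)%nat by (unfold n; lia).
    apply Rmult_le_compat_l; [apply iter_farey_op_ge_0; trivial; lra|].
    eapply Rle_trans; [apply ln_succ_bounds|].
    apply Rinv_le_contravar; [apply lt_0_INR; lia|].
    apply Rle_trans with (INR (S (S m) + i)); [apply le_INR; lia | lra]. }
  change (Nat.iter (S m) farey_op f 1) with (w (S m)). lra.
Qed.

(** * The limit along the Stern-Brocot sequence for increasing concave [x * f x] *)

Lemma is_lim_seq_ln : is_lim_seq (fun n => ln (INR n)) p_infty.
Proof.
  apply (filterlim_comp _ _ _ INR ln _ (Rbar_locally p_infty) (Rbar_locally p_infty)).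
  - apply is_lim_seq_INR.
  - apply is_lim_ln_p.
Qed.

Lemma is_lim_seq_const_div (a : R) (u : nat -> R) :
  is_lim_seq u p_infty -> is_lim_seq (fun n => a / u n) 0.
Proof.
  intro H. replace (Finite 0) with (Rbar_mult a 0) by (simpl; f_equal; ring).
  apply is_lim_seq_scal_l. replace (Finite 0) with (Rbar_inv p_infty) by reflexivity.
  now apply is_lim_seq_inv.
Qed.

Lemma is_lim_seq_Cesaro (u : nat -> R) (l : R) :
  is_lim_seq u l -> is_lim_seq (fun n => sum_f_R0 u n / INR (S n)) l.
Proof.
  intro H. apply is_lim_seq_Reals, Cesaro_1, is_lim_seq_Reals in H.
  now apply is_lim_seq_incr_1 in H.
Qed.

(** The upper bound alone forces w to 0, as the logarithm diverges. Then the Cesaro mean in the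
    lower bound vanishes too, and the two bounds meet. *)
Lemma is_lim_seq_iter_farey_op (f : R -> R) C :
  (forall x, 0 <= x <= 1 -> continuous f x) -> incr_concave (fun x => x * f x) ->
  (forall x, 0 <= x <= 1 -> f x <= C) ->
  is_lim_seq (fun n => Nat.iter n farey_op f 1 * ln (INR n)) (RInt f 0 1).
Proof.
  intros Hf Hu HC. set (w := fun j => Nat.iter j farey_op f 1).
  assert (Hw0 : forall n, 0 <= w n) by (intro; apply iter_farey_op_ge_0; trivial; lra).
  assert (Hlow := fun m => iter_farey_op_lower f C m Hf Hu HC).
  assert (Hup := fun m => iter_farey_op_upper f m Hf Hu).
  apply is_lim_seq_incr_1.
  assert (Hlnle : forall n, ln (INR (S n)) <= ln (INR n + 2)).
  { intro n. rewrite S_INR. assert (H := pos_INR n). apply ln_le; lra. }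
  assert (Hw : is_lim_seq w 0).
  { apply is_lim_seq_incr_1.
    apply is_lim_seq_le_le_loc with (fun _ => 0) (fun n => RInt f 0 1 / ln (INR (S n))).
    - exists 1%nat. intros n Hn. split; [apply Hw0|].
      assert (0 < ln (INR (S n))).
      { rewrite <- ln_1. apply ln_increasing; [lra|]. apply (lt_INR 1). lia. }
      apply (Rle_div_r (w (S n))); [easy|].
      eapply Rle_trans; [|apply (Hup n)]. apply Rmult_le_compat_l; [apply Hw0|apply Hlnle].
    - apply is_lim_seq_const.
    - apply is_lim_seq_const_div. apply (is_lim_seq_incr_1 (fun n => ln (INR n))).
      apply is_lim_seq_ln. }
  (* The term [2 * w (S m)] pays for replacing ln(M+2) by ln M, where M = [S m]. *)
  apply is_lim_seq_le_le with
    (fun m => RInt f 0 1 - C / (INR (S m) + 1) - sum_f_R0 w m / INR (S m) - 2 * w (S m))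
    (fun _ => RInt f 0 1).
  - intro m. split.
    (* For M >= 1 one has M + 2 <= 3 M <= M e^2. *)
    + assert (H3 : ln (INR (S m) + 2) <= ln (INR (S m)) + 2).
      { assert (H := pos_INR m). rewrite <- (ln_exp 2) at 2. rewrite S_INR.
        rewrite <- ln_mult; [|lra|apply exp_pos].
        apply ln_le; [lra|]. assert (H' := exp_ineq1_le 2). nra. }
      specialize (Hlow m). fold w in Hlow. fold (w (S m)) in Hlow. fold (w (S m)).
      assert (H4 := Rmult_le_compat_l (w (S m)) _ _ (Hw0 (S m)) H3). lra.
    + eapply Rle_trans; [|apply (Hup m)].
      apply Rmult_le_compat_l; [apply Hw0|apply Hlnle].
  - replace (Finite (RInt f 0 1)) with (Finite (RInt f 0 1 - 0 - 0 - 2 * 0)) by (f_equal; ring).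
    apply is_lim_seq_minus'; [apply is_lim_seq_minus'; [apply is_lim_seq_minus'|]|].
    + apply is_lim_seq_const.
    + apply is_lim_seq_const_div.
      apply is_lim_seq_le_p_loc with INR; [|apply is_lim_seq_INR].
      exists 0%nat. intros n _. rewrite S_INR. lra.
    + now apply is_lim_seq_Cesaro.
    + apply (is_lim_seq_scal_l (fun m => w (S m)) 2 0).
      now apply (is_lim_seq_incr_1 w).
  - apply is_lim_seq_const.
Qed.

(** By [farey_op_1] the value at 1 of the iterate [S n] is half the value at 1/2 of the iterate [n],
    hence twice the Dirac sum over [SB_set (S n)]. This factor 2 is the exponent in ln(n^2). *)
Lemma is_lim_seq_SB_incr_concave (f : R -> R) C :
  (forall x, 0 <= x <= 1 -> continuous f x) -> incr_concave (fun x => x * f x) ->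
  (forall x, 0 <= x <= 1 -> f x <= C) ->
  is_lim_seq (fun n => ln (INR n ^ 2) * dirac_sum f (SB_set n)) (RInt f 0 1).
Proof.
  intros Hf Hu HC. assert (H := is_lim_seq_iter_farey_op f C Hf Hu HC).
  apply is_lim_seq_incr_1 in H. apply is_lim_seq_incr_1.
  eapply is_lim_seq_ext; [|exact H]. intro n. cbv beta.
  change (Nat.iter (S n) farey_op f 1) with (farey_op (Nat.iter n farey_op f) 1).
  rewrite farey_op_1, dirac_sum_SB_set, <- Rsqr_pow2. unfold Rsqr.
  rewrite ln_mult by (apply lt_0_INR; lia). field.
Qed.

(** * Farey fractions *)

Lemma dirac_sum_incl f A B :
  NoDup A -> incl A B -> Forall fraction01 B -> (forall x, 0 <= x <= 1 -> 0 <= f x) ->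
  dirac_sum f A <= dirac_sum f B.
Proof.
  intros HA HAB HB Hf. revert B HAB HB.
  induction HA as [|x A HxA HA IH]; intros B HAB HB; [now apply dirac_sum_ge_0|].
  destruct (in_split x B) as [B1 [B2 ->]]; [apply HAB; now left|].
  apply Forall_app in HB. destruct HB as [HB1 HB2]. inversion_clear HB2 as [|? ? _ HB2'].
  enough (H : dirac_sum f A <= dirac_sum f (B1 ++ B2)).
  { rewrite dirac_sum_app in *. simpl. lra. }
  apply IH; [|apply Forall_app; now split].
  intros y Hy. assert (Hyx : y <> x) by (intros ->; contradiction).
  specialize (HAB y (or_intror Hy)).
  apply in_app_iff in HAB. apply in_app_iff. simpl in HAB. intuition congruence.
Qed.

Lemma NoDup_flat_map {A B} (g : A -> list B) l :
  NoDup l -> (forall a, In a l -> NoDup (g a)) ->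
  (forall a b x, In a l -> In b l -> In x (g a) -> In x (g b) -> a = b) ->
  NoDup (flat_map g l).
Proof.
  intros Hl. induction Hl as [|a l Ha Hl IH]; intros Hg Hd; simpl; [constructor|].
  apply NoDup_app.
  - apply Hg. now left.
  - apply IH; intros; [apply Hg | eapply Hd]; simpl; eauto.
  - intros x Hx Hx'. apply in_flat_map in Hx'. destruct Hx' as [b [Hb Hx']].
    apply Ha. rewrite (Hd a b x); simpl; auto.
Qed.

Definition unreduced_Farey_set (n : nat) : list (nat * nat) :=
  flat_map (fun q => map (fun p => (p, q)) (seq 1 q)) (seq 1 n).

Definition dilate (e : nat) (x : nat * nat) : nat * nat := (e * fst x, e * snd x)%nat.

Definition dilations (E : nat) (L : list (nat * nat)) : list (nat * nat) :=
  flat_map (fun e => map (dilate e) L) (seq 1 E).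

Lemma in_unreduced_Farey_set n x :
  In x (unreduced_Farey_set n) <-> (1 <= fst x <= snd x /\ snd x <= n)%nat.
Proof.
  unfold unreduced_Farey_set. rewrite in_flat_map. split.
  - intros [q [Hq Hx]]. apply in_map_iff in Hx. destruct Hx as [p [<- Hp]].
    apply in_seq in Hq, Hp. simpl. lia.
  - intro H. exists (snd x). rewrite in_seq, in_map_iff. split; [lia|].
    exists (fst x). rewrite in_seq. split; [now destruct x | lia].
Qed.

Lemma in_Farey_set n x :
  In x (Farey_set n) <->
  (1 <= fst x <= snd x /\ snd x <= n /\ Nat.gcd (fst x) (snd x) = 1)%nat.
Proof.
  unfold Farey_set. rewrite in_flat_map. split.
  - intros [q [Hq Hx]]. apply in_map_iff in Hx. destruct Hx as [p [<- Hp]].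
    apply filter_In in Hp. destruct Hp as [Hp Hg]. apply Nat.eqb_eq in Hg.
    apply in_seq in Hq, Hp. simpl. lia.
  - intro H. exists (snd x). rewrite in_seq, in_map_iff. split; [lia|].
    exists (fst x). rewrite filter_In, in_seq, Nat.eqb_eq. split; [now destruct x | lia].
Qed.

Lemma NoDup_rows (g : nat -> list nat) l :
  NoDup l -> (forall q, NoDup (g q)) ->
  NoDup (flat_map (fun q => map (fun p => (p, q)) (g q)) l).
Proof.
  intros Hl Hg. apply NoDup_flat_map; trivial.
  - intros q _. apply FinFun.Injective_map_NoDup; [|apply Hg]. intros p p' H. congruence.
  - intros q q' x _ _ H H'. apply in_map_iff in H, H'.
    destruct H as [p [<- _]], H' as [p' [H' _]]. congruence.
Qed.

(** The dilation factor of a coprime pair is recovered as the gcd, so different factors give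
    disjoint lists. *)
Lemma NoDup_dilations E n : NoDup (dilations E (Farey_set n)).
Proof.
  apply NoDup_flat_map; [apply seq_NoDup| |].
  - intros e He. apply in_seq in He. apply FinFun.Injective_map_NoDup.
    + intros [p q] [p' q'] H. unfold dilate in H. simpl in H. injection H as H1 H2.
      f_equal; nia.
    + apply NoDup_rows; [apply seq_NoDup | intro; apply NoDup_filter, seq_NoDup].
  - assert (Hgcd : forall e x, In x (map (dilate e) (Farey_set n)) ->
      Nat.gcd (fst x) (snd x) = e).
    { intros e x H. apply in_map_iff in H. destruct H as [y [<- Hy]].
      apply in_Farey_set in Hy. unfold dilate. simpl.
      rewrite Nat.gcd_mul_mono_l. lia. }
    intros e e' x _ _ H H'. apply Hgcd in H, H'. congruence.
Qed.

Lemma incl_dilations E n : incl (dilations E (Farey_set n)) (unreduced_Farey_set (n * E)).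
Proof.
  intros x Hx. apply in_flat_map in Hx. destruct Hx as [e [He Hx]].
  apply in_map_iff in Hx. destruct Hx as [y [<- Hy]]. apply in_seq in He.
  apply in_Farey_set in Hy. apply in_unreduced_Farey_set. unfold dilate. simpl. nia.
Qed.

(** Each pair is the dilation, by its gcd, of its reduced form; the gcd is at most [n]. *)
Lemma incl_unreduced_dilations n :
  incl (unreduced_Farey_set n) (dilations n (Farey_set n)).
Proof.
  intros [p q] Hx. apply in_unreduced_Farey_set in Hx. simpl in Hx.
  assert (Hg : Nat.gcd p q <> 0%nat) by (intro H; apply Nat.gcd_eq_0_l in H; lia).
  destruct (Nat.gcd_divide_l p q) as [p' Hp], (Nat.gcd_divide_r p q) as [q' Hq].
  assert (H1 := Nat.gcd_div_gcd p q _ Hg eq_refl).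
  set (g := Nat.gcd p q) in *.
  assert (Ep : (p / g = p')%nat) by (rewrite Hp; now apply Nat.div_mul).
  assert (Eq : (q / g = q')%nat) by (rewrite Hq; now apply Nat.div_mul).
  rewrite Ep, Eq in H1. clearbody g.
  assert (Hp' : (1 <= p')%nat) by (destruct p'; lia).
  assert (Hq' : (1 <= q')%nat) by (destruct q'; lia).
  apply in_flat_map. exists g. split; [apply in_seq; nia|].
  apply in_map_iff. exists (p', q'). split.
  - unfold dilate. simpl. f_equal; lia.
  - apply in_Farey_set. simpl. nia.
Qed.

Lemma Forall_fraction01_unreduced_Farey_set n : Forall fraction01 (unreduced_Farey_set n).
Proof.
  apply Forall_forall. intros x Hx. apply in_unreduced_Farey_set in Hx.
  unfold fraction01. lia.
Qed.

Lemma Forall_fraction01_Farey_set n : Forall fraction01 (Farey_set n).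
Proof.
  apply Forall_forall. intros x Hx. apply in_Farey_set in Hx. unfold fraction01. lia.
Qed.

Lemma Forall_fraction01_dilations E n : Forall fraction01 (dilations E (Farey_set n)).
Proof.
  eapply incl_Forall; [apply incl_dilations | apply Forall_fraction01_unreduced_Farey_set].
Qed.

Lemma dirac_sum_dilate f e L :
  (1 <= e)%nat -> Forall fraction01 L ->
  dirac_sum f (map (dilate e) L) = / (INR e) ^ 2 * dirac_sum f L.
Proof.
  intros He HL. apply lt_0_INR in He.
  induction HL as [|x L [_ Hx] HL IH]; simpl map.
  - simpl. ring.
  - change (weight f (dilate e x) + dirac_sum f (map (dilate e) L) =
            / INR e ^ 2 * (weight f x + dirac_sum f L)).
    rewrite IH, Rmult_plus_distr_l. f_equal.
    apply lt_0_INR in Hx. unfold weight, dilate. cbn [fst snd]. rewrite !mult_INR.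
    replace (INR e * INR (fst x) / (INR e * INR (snd x))) with (INR (fst x) / INR (snd x))
      by (field; lra).
    field. lra.
Qed.

(** * Dilations and the partial sums of zeta(2) *)

Definition zeta2_partial (k : nat) : R := sum_f_R0 (fun k => / (INR k + 1) ^ 2) k.

(** Dilation by e keeps the fraction and divides its weight by e^2. The index is shifted because
    [zeta2_partial k] has k+1 terms. *)
Lemma dirac_sum_dilations f k L :
  Forall fraction01 L ->
  dirac_sum f (dilations (S k) L) = zeta2_partial k * dirac_sum f L.
Proof.
  intro HL. unfold zeta2_partial. induction k as [|k IH].
  - unfold dilations. simpl seq. simpl flat_map. rewrite app_nil_r, dirac_sum_dilate by easy.
    simpl. field.
  - unfold dilations in *. rewrite seq_S, flat_map_app, dirac_sum_app, IH, tech5.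
    simpl plus. simpl flat_map. rewrite app_nil_r, dirac_sum_dilate by (trivial; lia).
    rewrite (S_INR (S k)). ring.
Qed.

(** The subtracted [/ (INR k + 1)] lets the induction telescope through 1/(k+2)^2 <= 1/(k+1) -
    1/(k+2). *)
Lemma zeta2_partial_le k : zeta2_partial k <= 2 - / (INR k + 1).
Proof.
  unfold zeta2_partial. induction k as [|k IH].
  - simpl. lra.
  - rewrite tech5. rewrite S_INR. assert (H := pos_INR k).
    enough (/ (INR k + 1 + 1) ^ 2 <= / (INR k + 1) - / (INR k + 1 + 1)) by lra.
    replace (/ (INR k + 1) - / (INR k + 1 + 1)) with (/ ((INR k + 1) * (INR k + 1 + 1)))
      by (field; lra).
    apply Rinv_le_contravar; nra.
Qed.

Lemma zeta2_partial_succ k : zeta2_partial k <= zeta2_partial (S k).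
Proof.
  unfold zeta2_partial. rewrite tech5.
  assert (0 < / (INR (S k) + 1) ^ 2).
  { apply Rinv_0_lt_compat, pow_lt. assert (H := pos_INR (S k)). lra. }
  lra.
Qed.

Lemma is_lim_seq_zeta2_partial : is_lim_seq zeta2_partial zeta2.
Proof.
  assert (He : ex_finite_lim_seq zeta2_partial).
  { apply ex_finite_lim_seq_incr with 2; [apply zeta2_partial_succ|].
    intro k. assert (H := zeta2_partial_le k). assert (B := inv_succ_bounds k). lra. }
  destruct He as [l Hl].
  assert (HS : is_series (fun k => / (INR k + 1) ^ 2) l).
  { eapply filterlim_ext; [|exact Hl]. intro k. symmetry. apply sum_n_Reals. }
  unfold zeta2. now rewrite (is_series_unique _ _ HS).
Qed.

Lemma zeta2_partial_le_zeta2 k : zeta2_partial k <= zeta2.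
Proof.
  apply is_lim_seq_incr_compare; [apply is_lim_seq_zeta2_partial | apply zeta2_partial_succ].
Qed.

Lemma zeta2_partial_ge_1 k : 1 <= zeta2_partial k.
Proof.
  induction k as [|k IH].
  - unfold zeta2_partial. simpl. lra.
  - assert (H := zeta2_partial_succ k). lra.
Qed.

(** * Riemann sums over all fractions with a given denominator *)

Definition lipschitz1 (f : R -> R) := forall x y, Rabs (f x - f y) <= Rabs (x - y).

Lemma lipschitz1_continuous f : lipschitz1 f -> forall x, continuous f x.
Proof.
  intros Hf x. apply filterlim_locally. intro eps. exists eps. intros y Hy.
  eapply Rle_lt_trans; [apply Hf | exact Hy].
Qed.

Lemma lipschitz1_RInt_rectangle f a b :
  lipschitz1 f -> a <= b -> Rabs ((b - a) * f b - RInt f a b) <= (b - a) ^ 2.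
Proof.
  intros Hf Hab.
  assert (HI : ex_RInt f a b).
  { apply (ex_RInt_continuous (V := R_CompleteNormedModule)).
    intros; now apply lipschitz1_continuous. }
  assert (Hc : forall c, RInt (fun _ => c) a b = (b - a) * c).
  { intro c. rewrite RInt_const. reflexivity. }
  assert (H1 : RInt f a b <= RInt (fun _ => f b + (b - a)) a b).
  { apply RInt_le; trivial; [apply ex_RInt_const|]. intros x Hx.
    assert (H := Hf x b). apply Rabs_le_between in H.
    rewrite (Rabs_left1 (x - b)) in H by lra. lra. }
  assert (H2 : RInt (fun _ => f b - (b - a)) a b <= RInt f a b).
  { apply RInt_le; trivial; [apply ex_RInt_const|]. intros x Hx.
    assert (H := Hf x b). apply Rabs_le_between in H.
    rewrite (Rabs_left1 (x - b)) in H by lra. lra. }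
  rewrite Hc in H1, H2. apply Rabs_le_between. lra.
Qed.

(** Times q, the row sum is a right-endpoint Riemann sum of mesh 1/q, and each of its [m] cells has
    error at most 1/q^2. Keeping [m] apart from [q] allows induction over the cells. *)
Lemma dirac_sum_row_aux f q m :
  lipschitz1 f -> (1 <= q)%nat ->
  Rabs (INR q * dirac_sum f (map (fun p => (p, q)) (seq 1 m)) - RInt f 0 (INR m / INR q)) <=
  INR m / INR q ^ 2.
Proof.
  intros Hf Hq. apply lt_0_INR in Hq.
  assert (HI : forall a b, ex_RInt f a b).
  { intros. apply (ex_RInt_continuous (V := R_CompleteNormedModule)).
    intros; now apply lipschitz1_continuous. }
  induction m as [|m IH].
  - simpl. replace (0 / INR q) with 0 by (field; lra).
    rewrite RInt_point, Rmult_0_r. unfold zero; simpl. rewrite Rminus_0_r, Rabs_R0.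
    unfold Rdiv. lra.
  - rewrite seq_S, map_app, dirac_sum_app.
    change (1 + m)%nat with (S m).
    change (dirac_sum f (map (fun p => (p, q)) [S m])) with (weight f (S m, q) + 0).
    unfold weight. cbn [fst snd].
    assert (HC : RInt f 0 (INR (S m) / INR q) =
                 RInt f 0 (INR m / INR q) + RInt f (INR m / INR q) (INR (S m) / INR q)).
    { symmetry. now apply (RInt_Chasles (V := R_CompleteNormedModule)). }
    assert (Hd : INR (S m) / INR q - INR m / INR q = / INR q)
      by (rewrite S_INR; field; lra).
    assert (Hinv : 0 < / INR q) by now apply Rinv_0_lt_compat.
    assert (HR := lipschitz1_RInt_rectangle f (INR m / INR q) (INR (S m) / INR q) Hf ltac:(lra)).
    rewrite Hd in HR. rewrite HC.
    set (A := dirac_sum f _) in *. set (J := RInt f 0 _) in *.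
    set (K := RInt f (INR m / INR q) _) in *. set (y := f (INR (S m) / INR q)) in *.
    replace (INR q * (A + (/ INR q ^ 2 * y + 0)) - (J + K))
      with ((INR q * A - J) + (/ INR q * y - K)) by (field; lra).
    eapply Rle_trans; [apply Rabs_triang|].
    replace (INR (S m) / INR q ^ 2) with (INR m / INR q ^ 2 + (/ INR q) ^ 2)
      by (rewrite S_INR; field; lra).
    now apply Rplus_le_compat.
Qed.

Lemma dirac_sum_row f n :
  lipschitz1 f ->
  Rabs (dirac_sum f (map (fun p => (p, S n)) (seq 1 (S n))) - RInt f 0 1 / (INR n + 1)) <=
  / (INR n + 1) ^ 2.
Proof.
  intro Hf. assert (H := dirac_sum_row_aux f (S n) (S n) Hf ltac:(lia)).
  assert (Hq := lt_0_INR (S n) ltac:(lia)). rewrite <- S_INR.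
  set (q := INR (S n)) in *. set (A := dirac_sum f _) in *.
  replace (q / q) with 1 in H by (field; lra).
  replace (A - RInt f 0 1 / q) with (/ q * (q * A - RInt f 0 1)) by (field; lra).
  assert (Hi : 0 < / q) by now apply Rinv_0_lt_compat.
  rewrite Rabs_mult, (Rabs_right (/ q)) by lra.
  replace (/ q ^ 2) with (/ q * (q / q ^ 2)) by (field; lra).
  apply Rmult_le_compat_l; lra.
Qed.

Lemma ln_le_sub_1 x : 0 < x -> ln x <= x - 1.
Proof. intro Hx. assert (H := exp_ineq1_le (ln x)). rewrite exp_ln in H by trivial. lra. Qed.

Lemma ln_increment x : 0 < x -> / (x + 1) <= ln (x + 1) - ln x <= / x.
Proof.
  intro Hx. assert (0 < / x) by now apply Rinv_0_lt_compat.
  assert (0 < / (x + 1)) by (apply Rinv_0_lt_compat; lra). split.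
  - assert (H1 := ln_le_sub_1 (x * / (x + 1)) ltac:(apply Rmult_lt_0_compat; lra)).
    rewrite ln_mult, ln_Rinv in H1 by lra.
    replace (x * / (x + 1) - 1) with (- / (x + 1)) in H1 by (field; lra). lra.
  - assert (H1 := ln_le_sub_1 ((x + 1) * / x) ltac:(apply Rmult_lt_0_compat; lra)).
    rewrite ln_mult, ln_Rinv in H1 by lra.
    replace ((x + 1) * / x - 1) with (/ x) in H1 by (field; lra). lra.
Qed.

(** The row of denominator q contributes I/q up to an error 1/q^2. The main terms form a harmonic
    sum, comparable to the logarithm, and the errors are summable. *)
Lemma dirac_sum_unreduced_bounds f n :
  lipschitz1 f -> 0 <= RInt f 0 1 ->
  RInt f 0 1 * ln (INR n + 2) - 2 <=
    dirac_sum f (unreduced_Farey_set (S n)) <= RInt f 0 1 * (1 + ln (INR n + 1)) + 2.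
Proof.
  intros Hf HI. set (I := RInt f 0 1) in *.
  (* The sharper error 2 - 1/(n+1) absorbs the next row by telescoping. *)
  enough (H : I * ln (INR n + 2) - (2 - / (INR n + 1)) <=
    dirac_sum f (unreduced_Farey_set (S n)) <=
    I * (1 + ln (INR n + 1)) + (2 - / (INR n + 1)))
    by (assert (B := inv_succ_bounds n); lra).
  assert (Hrow : forall n, I / (INR n + 1) - / (INR n + 1) ^ 2 <=
    dirac_sum f (map (fun p => (p, S n)) (seq 1 (S n))) <=
    I / (INR n + 1) + / (INR n + 1) ^ 2).
  { intro k. assert (H := dirac_sum_row f k Hf). apply Rabs_le_between in H.
    fold I in H. lra. }
  induction n as [|n IH].
  - unfold unreduced_Farey_set. change (seq 1 1) with [1%nat]. cbn [flat_map].
    rewrite app_nil_r. specialize (Hrow 0%nat). simpl INR in *.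
    assert (H2 := ln_increment 1 ltac:(lra)). rewrite ln_1 in H2.
    replace (0 + 2) with (1 + 1) by ring. replace (0 + 1) with 1 in * by ring.
    rewrite ln_1. replace (/ 1 ^ 2) with 1 in Hrow by field.
    rewrite Rdiv_1_r in Hrow. rewrite Rinv_1 in *.
    assert (I * ln (1 + 1) <= I * 1) by (apply Rmult_le_compat_l; lra). lra.
  - unfold unreduced_Farey_set in *. rewrite (seq_S (S n)), flat_map_app, dirac_sum_app.
    change (1 + S n)%nat with (S (S n)).
    replace (flat_map (fun q => map (fun p => (p, q)) (seq 1 q)) [S (S n)])
      with (map (fun p => (p, S (S n))) (seq 1 (S (S n)))) by (cbn [flat_map]; now rewrite app_nil_r).
    specialize (Hrow (S n)).
    set (A := dirac_sum f (map _ _)) in *. set (B := dirac_sum f (flat_map _ _)) in *.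
    rewrite (S_INR n) in *. assert (Hn := pos_INR n). set (x := INR n + 1) in *.
    replace (INR n + 2) with (x + 1) in * by (unfold x; ring).
    assert (L1 := ln_increment x ltac:(unfold x; lra)).
    assert (L2 := ln_increment (x + 1) ltac:(unfold x; lra)).
    replace (x + 1 + 1) with (x + 2) in * by ring.
    assert (Hsq : / (x + 1) ^ 2 <= / x - / (x + 1)).
    { assert (0 < x) by (unfold x; lra).
      replace (/ x - / (x + 1)) with (/ (x * (x + 1))) by (field; lra).
      apply Rinv_le_contravar; nra. }
    assert (M1 := Rmult_le_compat_l I _ _ HI (proj1 L1)).
    assert (M2 := Rmult_le_compat_l I _ _ HI (proj2 L2)).
    unfold Rdiv in Hrow. lra.
Qed.

(** * Asymptotics of the Farey sums *)

Lemma is_lim_seq_of_bounds (u : nat -> R) (l : R) :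
  (forall eps, 0 < eps -> exists N, forall n, (N <= n)%nat -> l - eps <= u n) ->
  (forall eps, 0 < eps -> exists N, forall n, (N <= n)%nat -> u n <= l + eps) ->
  is_lim_seq u l.
Proof.
  intros H1 H2. apply is_lim_seq_spec. intro eps.
  destruct (H1 (eps / 2)) as [N1 HN1]; [apply is_pos_div_2|].
  destruct (H2 (eps / 2)) as [N2 HN2]; [apply is_pos_div_2|].
  exists (max N1 N2). intros n Hn.
  specialize (HN1 n ltac:(lia)). specialize (HN2 n ltac:(lia)).
  assert (Hp := cond_pos eps). apply Rabs_lt_between. lra.
Qed.

Lemma Farey_lower f n :
  lipschitz1 f -> (forall x, 0 <= x <= 1 -> 0 <= f x) -> 0 <= RInt f 0 1 ->
  RInt f 0 1 * ln (INR n + 2) - 2 <= zeta2 * dirac_sum f (Farey_set (S n)).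
Proof.
  intros Hf H0 HI.
  eapply Rle_trans; [apply dirac_sum_unreduced_bounds; trivial|].
  eapply Rle_trans; [apply (dirac_sum_incl f _ (dilations (S n) (Farey_set (S n)))); trivial|].
  - apply NoDup_rows; [|intro]; apply seq_NoDup.
  - apply incl_unreduced_dilations.
  - apply Forall_fraction01_dilations.
  - rewrite dirac_sum_dilations by apply Forall_fraction01_Farey_set.
    apply Rmult_le_compat_r; [|apply zeta2_partial_le_zeta2].
    apply dirac_sum_ge_0; trivial. apply Forall_fraction01_Farey_set.
Qed.

(** Enlarging the bound on denominators by the factor [S k] costs only the additive ln(k+1), which
    is constant in [n]. *)
Lemma Farey_upper f n k :
  lipschitz1 f -> (forall x, 0 <= x <= 1 -> 0 <= f x) -> 0 <= RInt f 0 1 ->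
  zeta2_partial k * dirac_sum f (Farey_set (S n)) <=
  RInt f 0 1 * (1 + ln (INR (S n)) + ln (INR (S k))) + 2.
Proof.
  intros Hf H0 HI.
  rewrite <- dirac_sum_dilations by apply Forall_fraction01_Farey_set.
  eapply Rle_trans; [apply (dirac_sum_incl f _ (unreduced_Farey_set (S n * S k))); trivial|].
  - apply NoDup_dilations.
  - apply incl_dilations.
  - apply Forall_fraction01_unreduced_Farey_set.
  - rewrite Rplus_assoc, <- ln_mult by (apply lt_0_INR; lia). rewrite <- mult_INR.
    replace (S n * S k)%nat with (S (pred (S n * S k))) by lia. rewrite S_INR.
    now apply dirac_sum_unreduced_bounds.
Qed.

Lemma eventually_div_ln_le (c eps : R) :
  0 < eps -> exists N, forall n, (N <= n)%nat -> c / ln (INR n) <= eps.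
Proof.
  intro He. assert (H := is_lim_seq_const_div c _ is_lim_seq_ln).
  apply is_lim_seq_spec in H. destruct (H (mkposreal eps He)) as [N HN].
  exists N. intros n Hn. specialize (HN n Hn). simpl in HN.
  apply Rabs_lt_between in HN. lra.
Qed.

(** For the upper estimate [k] is fixed first, making zeta(2) over its partial sum close to 1; the
    constants depending on [k] then vanish after division by ln n. *)
Lemma is_lim_seq_Farey_lipschitz f :
  lipschitz1 f -> (forall x, 0 <= x <= 1 -> 0 <= f x) ->
  is_lim_seq (fun n => zeta2 / ln (INR n) * dirac_sum f (Farey_set n)) (RInt f 0 1).
Proof.
  intros Hf H0.
  assert (HI : 0 <= RInt f 0 1).
  { apply RInt_ge_0; [lra| |intros; apply H0; lra].
    apply (ex_RInt_continuous (V := R_CompleteNormedModule)).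
    intros; now apply lipschitz1_continuous. }
  assert (Hlow := fun n => Farey_lower f n Hf H0 HI).
  assert (Hup := fun n k => Farey_upper f n k Hf H0 HI).
  assert (HE : exists I : R, RInt f 0 1 = I) by eauto.
  destruct HE as [I HE]. rewrite HE in HI |- *.
  setoid_rewrite HE in Hlow. setoid_rewrite HE in Hup.
  assert (HZ : 1 <= zeta2).
  { assert (H1 := zeta2_partial_ge_1 0). assert (H2 := zeta2_partial_le_zeta2 0). lra. }
  assert (Hln : forall n, (2 <= n)%nat -> 0 < ln (INR n)).
  { intros n Hn. rewrite <- ln_1. apply ln_increasing; [lra|]. apply (lt_INR 1). lia. }
  apply is_lim_seq_of_bounds; intros eps Heps.
  - destruct (eventually_div_ln_le 2 eps Heps) as [N HN].
    exists (max N 2). intros n Hn. specialize (HN n ltac:(lia)).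
    assert (HL := Hln n ltac:(lia)).
    destruct n as [|n]; [lia|].
    assert (H := Hlow n).
    assert (HM : I * ln (INR (S n)) <= I * ln (INR n + 2)).
    { apply Rmult_le_compat_l; trivial. rewrite S_INR. assert (Hn' := pos_INR n).
      apply ln_le; lra. }
    set (L := ln (INR (S n))) in *.
    replace (zeta2 / L * dirac_sum f (Farey_set (S n)))
      with (zeta2 * dirac_sum f (Farey_set (S n)) / L) by (field; lra).
    apply Rle_trans with (I - 2 / L); [lra|].
    apply (Rle_div_r (I - 2 / L)); [easy|].
    replace ((I - 2 / L) * L) with (I * L - 2) by (field; lra). lra.
  - assert (Hk : exists k, zeta2 / zeta2_partial k * I <= I + eps / 2).
    { assert (Hlim : is_lim_seq (fun k => zeta2 / zeta2_partial k * I) (zeta2 / zeta2 * I)).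
      { apply is_lim_seq_mult'; [|apply is_lim_seq_const].
        apply is_lim_seq_div'; [apply is_lim_seq_const | apply is_lim_seq_zeta2_partial | lra]. }
      replace (zeta2 / zeta2 * I) with I in Hlim by (field; lra).
      apply is_lim_seq_spec in Hlim.
      destruct (Hlim (mkposreal (eps / 2) ltac:(lra))) as [k Hk].
      exists k. specialize (Hk k (le_n k)). simpl in Hk. apply Rabs_lt_between in Hk. lra. }
    destruct Hk as [k Hk].
    assert (Hz := zeta2_partial_ge_1 k). set (z := zeta2_partial k) in *.
    (* [c] gathers the part of the bound in [Farey_upper] that does not grow with [n]. *)
    pose (c := I * (1 + ln (INR (S k))) + 2).
    destruct (eventually_div_ln_le (zeta2 / z * c) (eps / 2) ltac:(lra)) as [N HN].
    exists (max N 2). intros n Hn. specialize (HN n ltac:(lia)).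
    assert (HL := Hln n ltac:(lia)).
    destruct n as [|n]; [lia|].
    assert (H := Hup n k). fold z in H.
    set (L := ln (INR (S n))) in *. set (a := dirac_sum f (Farey_set (S n))) in *.
    assert (Hq : 0 < zeta2 / z / L).
    { repeat apply Rdiv_lt_0_compat; lra. }
    assert (H' := Rmult_le_compat_l _ _ _ (Rlt_le _ _ Hq) H).
    replace (zeta2 / z / L * (z * a)) with (zeta2 / L * a) in H' by (field; lra).
    replace (zeta2 / z / L * (I * (1 + L + ln (INR (S k))) + 2))
      with (zeta2 / z * I + zeta2 / z * c / L) in H' by (unfold c; field; lra).
    lra.
Qed.

(** * From hinge functions to continuous functions *)

Definition hinge (a x : R) : R := Rmax 0 (x - a).

Lemma hinge_ge_0 a x : 0 <= hinge a x.
Proof. apply Rmax_l. Qed.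

Lemma hinge_incr a x y : x <= y -> hinge a x <= hinge a y <= hinge a x + (y - x).
Proof.
  intro H. unfold hinge, Rmax.
  destruct (Rle_dec 0 (x - a)), (Rle_dec 0 (y - a)); lra.
Qed.

Lemma lipschitz1_hinge a : lipschitz1 (hinge a).
Proof.
  intros x y. unfold hinge, Rmax, Rabs.
  destruct (Rle_dec 0 (x - a)), (Rle_dec 0 (y - a));
    repeat destruct Rcase_abs; lra.
Qed.

(** [RInt] is total, so integrability is carried along for the linearity of the integral. *)
Definition weak_lim (c : nat -> R) (A : nat -> list (nat * nat)) (f : R -> R) : Prop :=
  ex_RInt f 0 1 /\ is_lim_seq (fun n => c n * dirac_sum f (A n)) (RInt f 0 1).

Lemma weak_lim_plus c A f g :
  weak_lim c A f -> weak_lim c A g -> weak_lim c A (fun x => f x + g x).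
Proof.
  intros [If Lf] [Ig Lg]. split.
  - now apply (ex_RInt_plus (V := R_NormedModule)).
  - rewrite (RInt_plus (V := R_CompleteNormedModule)) by trivial.
    eapply is_lim_seq_ext; [|apply (is_lim_seq_plus' _ _ _ _ Lf Lg)].
    intro n. cbv beta. rewrite dirac_sum_plus. ring.
Qed.

Lemma weak_lim_scal c A k f : weak_lim c A f -> weak_lim c A (fun x => k * f x).
Proof.
  intros [If Lf]. split.
  - now apply (ex_RInt_scal (V := R_NormedModule)).
  - replace (RInt (fun x => k * f x) 0 1) with (k * RInt f 0 1)
      by (symmetry; exact (RInt_scal (V := R_CompleteNormedModule) f 0 1 k If)).
    eapply is_lim_seq_ext; [|apply (is_lim_seq_scal_l _ k _ Lf)].
    intro n. cbv beta. rewrite dirac_sum_scal. ring.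
Qed.

Lemma weak_lim_ext c A f g :
  (forall n, Forall fraction01 (A n)) -> (forall x, 0 <= x <= 1 -> f x = g x) ->
  weak_lim c A f -> weak_lim c A g.
Proof.
  intros HA H [If Lf].
  assert (H' : forall x, Rmin 0 1 < x < Rmax 0 1 -> f x = g x).
  { rewrite Rmin_left, Rmax_right by lra. intros x Hx. apply H. lra. }
  split.
  - now apply (ex_RInt_ext f).
  - rewrite <- (RInt_ext f g 0 1 H').
    eapply is_lim_seq_ext; [|exact Lf]. intro n. cbv beta.
    now rewrite (dirac_sum_ext f g).
Qed.

Lemma weak_lim_sum c A (F : nat -> R -> R) m :
  (forall i, weak_lim c A (F i)) -> weak_lim c A (fun x => sum_f_R0 (fun i => F i x) m).
Proof.
  intro H. induction m as [|m IH]; [apply H|]. now apply weak_lim_plus.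
Qed.

(** The hat function of height 1 centred at ih with half-width h, as a second difference of
    hinges. *)
Definition tent (h : R) (i : nat) (x : R) : R :=
  / h * (hinge ((INR i - 1) * h) x + (-2) * hinge (INR i * h) x + hinge ((INR i + 1) * h) x).

Lemma tent_ge_0 h i x : 0 < h -> 0 <= tent h i x.
Proof.
  intro Hh. unfold tent. apply Rmult_le_pos; [left; now apply Rinv_0_lt_compat|].
  replace ((INR i - 1) * h) with (INR i * h - h) by ring.
  replace ((INR i + 1) * h) with (INR i * h + h) by ring.
  set (t := INR i * h). unfold hinge, Rmax.
  destruct (Rle_dec 0 (x - (t - h))), (Rle_dec 0 (x - t)), (Rle_dec 0 (x - (t + h))); lra.
Qed.

Lemma tent_support h i x : 0 < h -> h <= Rabs (x - INR i * h) -> tent h i x = 0.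
Proof.
  intros Hh. unfold tent.
  replace ((INR i - 1) * h) with (INR i * h - h) by ring.
  replace ((INR i + 1) * h) with (INR i * h + h) by ring.
  set (t := INR i * h). intro H.
  replace (_ + _ + _) with 0; [ring|]. revert H. unfold hinge, Rmax, Rabs.
  destruct (Rcase_abs (x - t)), (Rle_dec 0 (x - (t - h))), (Rle_dec 0 (x - t)),
    (Rle_dec 0 (x - (t + h))); lra.
Qed.

(** The second differences telescope to first differences at the two ends. On [0,1] the left one
    equals h and the right one vanishes. *)
Lemma sum_tent N x :
  0 <= x <= 1 -> sum_f_R0 (fun i => tent (/ (INR N + 1)) i x) (S N) = 1.
Proof.
  intro Hx. set (h := / (INR N + 1)).
  assert (Hh : 0 < h <= 1) by apply inv_succ_bounds.
  assert (Hm : forall m, sum_f_R0 (fun i => tent h i x) m =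
    / h * ((hinge (- h) x - hinge 0 x) - (hinge (INR m * h) x - hinge ((INR m + 1) * h) x))).
  { induction m as [|m IH].
    - simpl. unfold tent. simpl INR. replace ((0 - 1) * h) with (- h) by ring.
      rewrite Rmult_0_l. ring.
    - rewrite tech5, IH. unfold tent. rewrite !S_INR.
      replace (INR m + 1 - 1) with (INR m) by ring. ring. }
  rewrite Hm. replace (INR (S N) * h) with 1
    by (unfold h; rewrite S_INR; assert (HN := pos_INR N); field; lra).
  replace ((INR (S N) + 1) * h) with (1 + h)
    by (unfold h; rewrite S_INR; assert (HN := pos_INR N); field; lra).
  unfold hinge. rewrite (Rmax_right 0 (x - - h)), (Rmax_right 0 (x - 0)),
    (Rmax_left 0 (x - 1)), (Rmax_left 0 (x - (1 + h))) by lra.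
  field. lra.
Qed.

Lemma weak_lim_tent c A h i : (forall a, weak_lim c A (hinge a)) -> weak_lim c A (tent h i).
Proof.
  intro H. apply weak_lim_scal. apply weak_lim_plus; [|apply H].
  apply weak_lim_plus; [apply H | apply weak_lim_scal, H].
Qed.

(** The retraction onto [0,1]: composing with it turns continuity relative to [0,1] into continuity
    on the whole line. *)
Definition clamp (x : R) : R := Rmax 0 (Rmin 1 x).

Lemma clamp_bounds x : 0 <= clamp x <= 1.
Proof. unfold clamp, Rmax, Rmin. destruct (Rle_dec 1 x); destruct Rle_dec; lra. Qed.

Lemma clamp_id x : 0 <= x <= 1 -> clamp x = x.
Proof. intro H. unfold clamp. rewrite Rmin_right, Rmax_right; lra. Qed.

Lemma lipschitz1_clamp : lipschitz1 clamp.
Proof.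
  intros x y. unfold clamp, Rmax, Rmin, Rabs.
  destruct (Rle_dec 1 x), (Rle_dec 1 y); repeat destruct Rle_dec;
    repeat destruct Rcase_abs; lra.
Qed.

Lemma continuous_on01_clamp f : continuous_on01 f -> forall x, continuous (fun y => f (clamp y)) x.
Proof.
  intros Hf x. eapply filterlim_comp; [|apply Hf, clamp_bounds].
  intros P HP. unfold within in HP.
  assert (H := lipschitz1_continuous clamp lipschitz1_clamp x _ HP).
  unfold filtermap in *. eapply filter_imp; [|exact H].
  intros y Hy. apply Hy, clamp_bounds.
Qed.

(** Piecewise linear interpolation: the tents sum to 1, and those not vanishing at x are centred
    within h of x, where uniform continuity applies. *)
Lemma tent_approximation f eps :
  (forall x, 0 <= x <= 1 -> continuous f x) -> 0 < eps ->
  exists N, forall x, 0 <= x <= 1 ->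
    Rabs (f x - sum_f_R0 (fun i =>
      f (INR i * / (INR N + 1)) * tent (/ (INR N + 1)) i x) (S N)) <= eps.
Proof.
  intros Hf Heps.
  destruct (unifcont_1d f 0 1 Hf (mkposreal eps Heps)) as [delta Hd].
  destruct (archimed_cor1 delta (cond_pos delta)) as [M [HM HM0]].
  exists (pred M). set (h := / (INR (pred M) + 1)).
  assert (Hh0 : 0 < h <= 1) by apply inv_succ_bounds.
  assert (Hh : h < delta).
  { unfold h. now rewrite <- S_INR, Nat.succ_pred by lia. }
  assert (HN : (INR (pred M) + 1) * h = 1).
  { unfold h. field. assert (H := pos_INR (pred M)). lra. }
  intros x Hx.
  replace (f x) with (f x * 1) by ring. rewrite <- (sum_tent (pred M) x Hx). fold h.
  rewrite scal_sum, <- minus_sum.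
  eapply Rle_trans; [apply sum_f_R0_triangle|].
  rewrite <- (Rmult_1_r eps), <- (sum_tent (pred M) x Hx), scal_sum. fold h.
  apply sum_Rle. intros i Hi.
  assert (HT := tent_ge_0 h i x (proj1 Hh0)).
  replace (tent h i x * f x - f (INR i * h) * tent h i x)
    with (tent h i x * (f x - f (INR i * h))) by ring.
  rewrite Rabs_mult, (Rabs_right (tent h i x)) by lra.
  destruct (Rle_dec h (Rabs (x - INR i * h))) as [H|H].
  - rewrite tent_support by (trivial; lra). lra.
  - apply Rmult_le_compat_l; trivial.
    assert (Hi1 : 0 <= INR i * h <= 1).
    { split; [apply Rmult_le_pos; [apply pos_INR | lra]|]. rewrite <- HN.
      apply Rmult_le_compat_r; [lra|]. rewrite <- S_INR. now apply le_INR. }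
    (* [unifcont_1d] ends in a double negation, so the inequality is decided and its failure
       refuted. *)
    destruct (Rle_dec (Rabs (f x - f (INR i * h))) eps) as [Hle|Hle]; trivial.
    exfalso. apply (Hd (INR i * h) x Hi1 Hx).
    + change (Rabs (x - INR i * h) < delta). lra.
    + intro Hb. change (Rabs (f x - f (INR i * h)) < eps) in Hb. lra.
Qed.

(** [f] is squeezed between g - eps/4 and g + eps/4 with g a combination of tents. Both bounds have
    weak limits, since the constant 1 is itself a combination of hinges on [0,1]. *)
Lemma weak_lim_of_hinges c A f :
  (exists N, forall n, (N <= n)%nat -> 0 <= c n) -> (forall n, Forall fraction01 (A n)) ->
  (forall a, weak_lim c A (hinge a)) -> (forall x, 0 <= x <= 1 -> continuous f x) ->
  weak_lim c A f.
Proof.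
  intros [N0 Hc] HA Hh Hf.
  assert (If : ex_RInt f 0 1) by (apply ex_RInt_sub01; trivial; lra).
  split; [exact If|].
  assert (H1 : weak_lim c A (fun _ => 1)).
  { apply (weak_lim_ext c A (fun x => hinge (-1) x + (-1) * hinge 0 x)); trivial.
    - intros x Hx. unfold hinge. rewrite !Rmax_right; lra.
    - apply weak_lim_plus; [apply Hh | apply weak_lim_scal, Hh]. }
  assert (key : forall eps, 0 < eps -> exists N, forall n, (N <= n)%nat ->
    Rabs (c n * dirac_sum f (A n) - RInt f 0 1) <= eps).
  { intros eps Heps.
    destruct (tent_approximation f (eps / 4) Hf ltac:(lra)) as [M HM].
    set (g := fun x => sum_f_R0 (fun i => f (INR i * / (INR M + 1)) *
                                  tent (/ (INR M + 1)) i x) (S M)) in *.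
    assert (Hg : weak_lim c A g).
    { apply (weak_lim_sum c A (fun i x => f (INR i * / (INR M + 1)) *
                                          tent (/ (INR M + 1)) i x)).
      intro i. now apply weak_lim_scal, weak_lim_tent. }
    assert (HM' : forall x, 0 <= x <= 1 -> g x + (- (eps / 4)) * 1 <= f x <= g x + eps / 4 * 1).
    { intros x Hx. specialize (HM x Hx). change (Rabs (f x - g x) <= eps / 4) in HM.
      apply Rabs_le_between in HM. lra. }
    assert (HJ : forall k, weak_lim c A (fun x => g x + k * 1)).
    { intro k. apply (weak_lim_plus c A g (fun _ => k * 1)); trivial.
      now apply (weak_lim_scal c A k (fun _ => 1)). }
    assert (HI : forall k, RInt (fun x => g x + k * 1) 0 1 = RInt g 0 1 + k).
    { intro k. rewrite (RInt_plus (V := R_CompleteNormedModule) g (fun _ => k * 1));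
        [|apply Hg|apply ex_RInt_const].
      rewrite RInt_const. change (RInt g 0 1 + (1 - 0) * (k * 1) = RInt g 0 1 + k). ring. }
    assert (B1 : RInt g 0 1 + - (eps / 4) <= RInt f 0 1).
    { rewrite <- HI. apply RInt_le; [lra | apply HJ | trivial |].
      intros x Hx. apply HM'. lra. }
    assert (B2 : RInt f 0 1 <= RInt g 0 1 + eps / 4).
    { rewrite <- HI. apply RInt_le; [lra | trivial | apply HJ |].
      intros x Hx. apply HM'. lra. }
    destruct (HJ (- (eps / 4))) as [_ L1]. rewrite HI in L1.
    destruct (HJ (eps / 4)) as [_ L2]. rewrite HI in L2.
    apply is_lim_seq_spec in L1, L2.
    destruct (L1 (mkposreal (eps / 4) ltac:(lra))) as [N1 HN1].
    destruct (L2 (mkposreal (eps / 4) ltac:(lra))) as [N2 HN2].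
    exists (max N0 (max N1 N2)). intros n Hn.
    specialize (HN1 n ltac:(lia)). specialize (HN2 n ltac:(lia)). specialize (Hc n ltac:(lia)).
    simpl in HN1, HN2. apply Rabs_lt_between in HN1, HN2.
    assert (C1 := Rmult_le_compat_l _ _ _ Hc
      (dirac_sum_le _ _ _ (HA n) (fun x Hx => proj1 (HM' x Hx)))).
    assert (C2 := Rmult_le_compat_l _ _ _ Hc
      (dirac_sum_le _ _ _ (HA n) (fun x Hx => proj2 (HM' x Hx)))).
    apply Rabs_le_between. lra. }
  apply is_lim_seq_of_bounds; intros eps Heps; destruct (key eps Heps) as [N HN];
    exists N; intros n Hn; specialize (HN n Hn); apply Rabs_le_between in HN; lra.
Qed.

Lemma weak_lim_continuous_on01 c A f :
  (exists N, forall n, (N <= n)%nat -> 0 <= c n) -> (forall n, Forall fraction01 (A n)) ->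
  (forall a, weak_lim c A (hinge a)) -> continuous_on01 f -> weak_lim c A f.
Proof.
  intros Hc HA Hh Hf.
  apply (weak_lim_ext c A (fun x => f (clamp x))); trivial.
  - intros x Hx. now rewrite clamp_id.
  - apply weak_lim_of_hinges; trivial. intros x _. now apply continuous_on01_clamp.
Qed.

(** A hinge is convex, so it is subtracted from a constant. On [0,1] the hinge is at most 1 + |a|
    and has slope at most 1, so 2 + |a| keeps the product nondecreasing. Concavity follows from
    convexity of the hinge and a covariance term, nonnegative because the hinge increases. *)
Lemma incr_concave_hinge a : incr_concave (fun x => x * (2 + Rabs a - hinge a x)).
Proof.
  split.
  - intros x y Hx Hxy Hy.
    assert (H1 := hinge_incr a x y Hxy).
    assert (H2 : hinge a x <= 1 + Rabs a).
    { unfold hinge. assert (H := Rle_abs (- a)). rewrite Rabs_Ropp in H.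
      assert (H0 := Rabs_pos a). apply Rmax_lub; lra. }
    assert (H3 : y * (hinge a y - hinge a x) <= y - x) by nra.
    assert (H4 : 0 <= (y - x) * (1 + Rabs a - hinge a x)) by (apply Rmult_le_pos; lra).
    nra.
  - intros x y t Hx Hy Ht. set (z := t * x + (1 - t) * y). set (K := 2 + Rabs a).
    assert (Hz : 0 <= z <= 1) by (unfold z; nra).
    assert (H1 : hinge a z <= t * hinge a x + (1 - t) * hinge a y).
    { apply Rmax_lub.
      - assert (Hx' := hinge_ge_0 a x). assert (Hy' := hinge_ge_0 a y).
        assert (0 <= t * hinge a x) by (apply Rmult_le_pos; lra).
        assert (0 <= (1 - t) * hinge a y) by (apply Rmult_le_pos; lra). lra.
      - assert (Hx' : x - a <= hinge a x) by apply Rmax_r.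
        assert (Hy' : y - a <= hinge a y) by apply Rmax_r.
        assert (A1 := Rmult_le_compat_l t _ _ ltac:(lra) Hx').
        assert (A2 := Rmult_le_compat_l (1 - t) _ _ ltac:(lra) Hy').
        unfold z. lra. }
    assert (H2 : 0 <= (x - y) * (hinge a x - hinge a y)).
    { destruct (Rle_dec x y) as [H|H].
      - assert (H' := hinge_incr a x y H). nra.
      - assert (H' := hinge_incr a y x ltac:(lra)). nra. }
    assert (H3 : 0 <= t * (1 - t) * ((x - y) * (hinge a x - hinge a y)))
      by (apply Rmult_le_pos; [nra | easy]).
    assert (H4 := Rmult_le_compat_l z _ _ (proj1 Hz) H1).
    replace (t * (x * (K - hinge a x)) + (1 - t) * (y * (K - hinge a y)))
      with (z * (K - (t * hinge a x + (1 - t) * hinge a y)) -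
            t * (1 - t) * ((x - y) * (hinge a x - hinge a y))) by (unfold z; ring).
    lra.
Qed.

(** The hinge is a difference of two functions of the increasing concave class, a constant and
    [K - hinge a x]. *)
Lemma weak_lim_SB_hinge a : weak_lim (fun n => ln (INR n ^ 2)) SB_set (hinge a).
Proof.
  set (K := 2 + Rabs a).
  assert (HC : forall x, continuous (fun x => K - hinge a x) x).
  { intro x. apply (continuous_minus (fun _ => K) (hinge a)); [apply continuous_const|].
    apply lipschitz1_continuous, lipschitz1_hinge. }
  apply (weak_lim_ext _ _ (fun x => K * 1 + (-1) * (K - hinge a x))).
  - apply Forall_fraction01_SB_set.
  - intros. ring.
  - apply (weak_lim_plus _ _ (fun _ => K * 1)); [apply (weak_lim_scal _ _ K (fun _ => 1))|
      apply (weak_lim_scal _ _ (-1) (fun x => K - hinge a x))]; split.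
    + apply ex_RInt_const.
    + apply (is_lim_seq_SB_incr_concave _ 1).
      * intros. apply continuous_const.
      * split; intros; lra.
      * intros. lra.
    + apply ex_RInt_sub01; trivial; lra.
    + apply (is_lim_seq_SB_incr_concave _ K); trivial.
      * apply incr_concave_hinge.
      * intros x _. assert (H := hinge_ge_0 a x). lra.
Qed.

Lemma weak_lim_Farey_hinge a : weak_lim (fun n => zeta2 / ln (INR n)) Farey_set (hinge a).
Proof.
  split.
  - apply ex_RInt_sub01; [|lra..]. intros. apply lipschitz1_continuous, lipschitz1_hinge.
  - apply is_lim_seq_Farey_lipschitz; [apply lipschitz1_hinge|].
    intros. apply hinge_ge_0.
Qed.

Theorem theorem1p1 :
  forall f : R -> R, continuous_on01 f ->
    is_lim_seq (fun n => ln (INR n ^ 2) * dirac_sum f (SB_set n)) (RInt f 0 1) /\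
    is_lim_seq (fun n => zeta2 / ln (INR n) * dirac_sum f (Farey_set n)) (RInt f 0 1).
Proof.
  intros f Hf.
  assert (HINR : forall n, (2 <= n)%nat -> 1 < INR n) by (intros n Hn; apply (lt_INR 1); lia).
  split.
  - apply (weak_lim_continuous_on01 (fun n => ln (INR n ^ 2)) SB_set); trivial.
    + exists 2%nat. intros n Hn. specialize (HINR n Hn). rewrite <- ln_1. apply ln_le; nra.
    + apply Forall_fraction01_SB_set.
    + apply weak_lim_SB_hinge.
  - apply (weak_lim_continuous_on01 (fun n => zeta2 / ln (INR n)) Farey_set); trivial.
    + exists 2%nat. intros n Hn. specialize (HINR n Hn). apply Rdiv_le_0_compat.
      * assert (H1 := zeta2_partial_ge_1 0). assert (H2 := zeta2_partial_le_zeta2 0). lra.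
      * rewrite <- ln_1. apply ln_increasing; lra.
    + apply Forall_fraction01_Farey_set.
    + apply weak_lim_Farey_hinge.
Qed.
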